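(* Let $\mathcal{D}^{\beta}$ be a dyadic grid in $\mathbb{R}^d$ and let $\{\lambda_{Q}\}_{Q \in \mathcal{D}^{\beta}}$ be a sequence of positive numbers indexed by $\mathcal{D}^{\beta}$. Let $\sigma_{1},\dots,\sigma_{n}$ be weights on $\mathbb{R}^{d}$ and let $\Phi_{1},\dots,\Phi_{n} \in \widetilde{\mathcal{U}}\cap \nabla_{2}$. Suppose $\Psi\in \mathcal{U}$ and that $\Phi$ is a bijection from $\mathbb{R}_{+}$ to $\mathbb{R}_{+}$ such that $\Phi^{-1}=\Phi_{1}^{-1}\times\cdots\times \Phi_{n}^{-1}$ (pointwise product) and $t\mapsto \frac{\Psi(t)}{\Phi(t)}$ is increasing on $\mathbb{R}_{+}^{*}$. Define $$\nu_{\vec{\sigma}}:=\frac{1}{\Phi\left(\prod_{i=1}^{n}\Phi_{i}^{-1}\left(\frac{1}{\sigma_{i}}\right)\right)}.$$ If there exists a constant $\Lambda>0$ such that $$\sum_{Q \subset R,\ Q \in \mathcal{D}^{\beta}}\lambda_{Q} \leq \frac{\Lambda}{\Psi\circ\Phi^{-1}\left(\frac{1}{\nu_{\vec{\sigma}}(R)}\right)}\qquad\text{for all } R\in \mathcal{D}^{\beta},$$ then there is a constant $C=C_{n,\Phi,\Psi,\Phi_{1},\dots,\Phi_{n}}>0$ such that for any $(f_{1},\dots,f_{n})\in L^{\Phi_{1}}(\sigma_{1})\times\cdots\times L^{\Phi_{n}}(\sigma_{n})$ with $f_{i}\not\equiv 0$ for $i=1,\dots,n$, $$\sum_{Q\in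 \mathcal{D}^{\beta}}\lambda_{Q}\Psi\left(\prod_{i=1}^{n}\frac{1}{\sigma_{i}(Q)}\int_{Q}\frac{|f_{i}(x)|}{\|f_{i}\|_{L_{\sigma_{i}}^{\Phi_{i}}}^{lux}}\sigma_{i}(x)\,dx\right) \leq C\,\Lambda.$$
   Context: $\mathbb{R}_+=[0,\infty)$ and $\mathbb{R}_+^*=(0,\infty)$. A weight is a locally integrable, almost everywhere positive function $\sigma$ on $\mathbb{R}^d$; $\sigma(E)=\int_E\sigma(x)\,dx$ (the same notation is used for $\nu_{\vec\sigma}$). Growth functions: a growth function is a function $\Phi:\mathbb{R}_+\to\mathbb{R}_+$, not identically zero, continuous, nondecreasing and onto. It is of upper-type $q>0$ if there is $C_q>0$ with $\Phi(st)\le C_q t^q\Phi(s)$ for all $s>0$, $t\ge 1$. For $q\ge1$, $\mathcal{U}^q$ is the set of growth functions of upper-type $q$ such that $t\mapsto\Phi(t)/t$ is nondecreasing on $\mathbb{R}_+^*$; $\mathcal{U}=\bigcup_{q\ge1}\mathcal{U}^q$. Standing convention: (up to replacing it by an equivalent function) every $\Phi\in\mathcal{U}$ is assumed convex, of class $C^1$, with $\Phi'(t)\approx\Phi(t)/t$ for $t>0$. $\Phi\in\Delta'$ means there is $C>0$ with $\Phi(st)\le C\Phi(s)\Phi(t)$ for all $s,t>0$. $\Phi\in\Delta_2$ means there is $K>0$ with $\Phi(2t)\le K\Phi(t)$ for all $t>0$. For a convex growth function $\Phi\in\Delta_2$, $\Phi\in\nabla_2$ means there is $C>0$ with $\int_0^t\frac{\Phi(s)}{s^2}ds\le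 C\frac{\Phi(t)}{t}$ for all $t>0$. For $q\ge1$, $\widetilde{\mathcal{U}}^q$ is the set of $\Phi\in\mathcal{U}^q\cap\Delta'$ for which there is $C>0$ with $\Phi(s/t)\le C\,\Phi(s)/t^q$ for all $s,t\ge1$; $\widetilde{\mathcal{U}}=\bigcup_{q\ge1}\widetilde{\mathcal{U}}^q$. Weighted Orlicz space: for $\Phi\in\mathcal{U}$ and a weight $\sigma$, $L^\Phi(\sigma)$ is the set of (classes of) measurable $f:\mathbb{R}^d\to\mathbb{C}$ with $\|f\|_{L^\Phi_\sigma}^{lux}:=\inf\{\lambda>0:\int_{\mathbb{R}^d}\Phi(|f(x)|/\lambda)\sigma(x)dx\le1\}<\infty$. A dyadic grid $\mathcal{D}^\beta$ in $\mathbb{R}^d$ is a collection of cubes such that: each has sidelength $2^k$ for some $k\in\mathbb{Z}$; for $Q,Q'\in\mathcal{D}^\beta$, $Q\cap Q'\in\{Q,Q',\emptyset\}$; for each $k\in\mathbb{Z}$ the cubes of sidelength $2^k$ in $\mathcal{D}^\beta$ form a partition of $\mathbb{R}^d$. *)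

(* Defs.v *)
From HB Require Import structures.
From mathcomp Require Import all_boot all_order all_algebra.
From mathcomp Require Import complex.
From mathcomp Require Import all_classical all_reals all_analysis.

Set Implicit Arguments.
Unset Strict Implicit.
Unset Printing Implicit Defensive.
Import Order.TTheory GRing.Theory Num.Theory.
Import numFieldNormedType.Exports.

Local Open Scope classical_set_scope.
Local Open Scope ring_scope.

Definition Rplus (R : realType) : set R := `[0, +oo[.
Definition Rpstar (R : realType) : set R := `]0, +oo[.
Arguments Rplus {R}.
Arguments Rpstar {R}.

(** A function from R_+ to R_+ is encoded as a function on
    R; only its values on [0, +oo[ are constrained, and only those are used. *)

Record growth_function (R : realType) (Phi : R -> R) : Prop := GrowthFunction {
  growth_ge0 : forall t, 0 <= t -> 0 <= Phi t;
  growth_neq0 : exists2 t, 0 <= t & Phi t != 0;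
  growth_continuous : {within Rplus, continuous Phi};
  growth_nondecreasing : forall s t, 0 <= s -> s <= t -> Phi s <= Phi t;
  growth_surj : set_surj Rplus Rplus Phi }.

Definition upper_type (R : realType) (q : R) (Phi : R -> R) : Prop :=
  0 < q /\ exists2 C : R, 0 < C &
    forall s t, 0 < s -> 1 <= t -> Phi (s * t) <= C * t `^ q * Phi s.

Definition class_Uq (R : realType) (q : R) (Phi : R -> R) : Prop :=
  [/\ growth_function Phi, upper_type q Phi &
      forall s t, 0 < s -> s <= t -> Phi s / s <= Phi t / t].

Definition class_U (R : realType) (Phi : R -> R) : Prop :=
  exists2 q : R, 1 <= q & class_Uq q Phi.

(** The standing normalization of the elements of [class_U].  For a convex
    function, being C^1 on ]0, +oo[ already gives being C^1 on [0, +oo[. *)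
Record standing_U (R : realType) (Phi : R -> R) : Prop := StandingU {
  standing_convex : convex_function Rplus Phi;
  standing_derivable : forall t, 0 < t -> derivable Phi t 1;
  standing_C1 : {in Rpstar, continuous (derive1 Phi)};
  standing_derive : exists c C : R, [/\ 0 < c, 0 < C & forall t, 0 < t ->
    c * (Phi t / t) <= derive1 Phi t <= C * (Phi t / t)] }.

Definition Delta_prime (R : realType) (Phi : R -> R) : Prop :=
  exists2 C : R, 0 < C &
    forall s t, 0 < s -> 0 < t -> Phi (s * t) <= C * Phi s * Phi t.

Definition Delta_2 (R : realType) (Phi : R -> R) : Prop :=
  exists2 K : R, 0 < K & forall t, 0 < t -> Phi (2 * t) <= K * Phi t.

Definition nabla_2 (R : realType) (Phi : R -> R) : Prop :=
  [/\ growth_function Phi, convex_function Rplus Phi, Delta_2 Phi &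
    exists2 C : R, 0 < C & forall t, 0 < t ->
      (\int[@lebesgue_measure R]_(s in `]0%R, t]) (Phi s / s ^+ 2)%:E
         <= (C * (Phi t / t))%:E)%E].

Definition class_Utildeq (R : realType) (q : R) (Phi : R -> R) : Prop :=
  [/\ class_Uq q Phi, Delta_prime Phi &
    exists2 C : R, 0 < C &
      forall s t, 1 <= s -> 1 <= t -> Phi (s / t) <= C * (Phi s / t `^ q)].

Definition class_Utilde (R : realType) (Phi : R -> R) : Prop :=
  exists2 q : R, 1 <= q & class_Utildeq q Phi.

(** The inverse of [Phi] when [Phi] restricts to a bijection of R_+, as every
    member of [class_U] does. *)
Definition inv_Rplus (R : realType) (Phi : R -> R) : R -> R := pinv Rplus Phi.

(** Lebesgue measure on R^d, with R^d the [d]-tuples of reals equipped with the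
    product Borel sigma-algebra, by iterated products:
    R^(d+1) is the image of R * R^d. *)

Notation euclid R d := (d.-tuple (measurableTypeR R)).

Section lebesgue_tuple.
Context {R : realType}.

Definition tuple_cons d (p : measurableTypeR R * euclid R d) : euclid R d.+1 :=
  [the d.+1.-tuple (measurableTypeR R) of p.1 :: p.2].

Lemma measurable_tuple_cons d : measurable_fun [set: _] (@tuple_cons d).
Proof. exact: (measurable_cons measurable_fst measurable_snd). Qed.

Section succ.
Variables (d : nat) (mu : {sigma_finite_measure set (euclid R d) -> \bar R}).

Let lebprod : {measure set (measurableTypeR R * euclid R d)%type -> \bar R} :=
  (lebesgue_measure \x mu)%E.

Definition lebesgue_succ : set (euclid R d.+1) -> \bar R :=
  pushforward lebprod (@tuple_cons d).

Let lebprod_sigma_finite : sigma_finite setT lebprod.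
Proof.
have /sigma_finiteP[F [TF ndF Foo]] := sigma_finiteT (@lebesgue_measure R).
have /sigma_finiteP[G [TG ndG Goo]] := sigma_finiteT mu.
exists (fun n => F n `*` G n).
  rewrite -setXTT TF TG predeqE => -[x y]; split.
    move=> [/= [n _ Fnx] [k _ Gky]]; exists (maxn n k) => //; split.
    - by move: x Fnx; exact/subsetPset/ndF/leq_maxl.
    - by move: y Gky; exact/subsetPset/ndG/leq_maxr.
  by move=> [n _ []/= ? ?]; split; exists n.
move=> k; have [? ?] := Foo k; have [? ?] := Goo k.
split; first exact: measurableX.
by rewrite /lebprod/= product_measure1E// lte_mul_pinfty// ge0_fin_numE.
Qed.

Let pre_measurable A : measurable A -> measurable (@tuple_cons d @^-1` A).
Proof. by move=> mA; rewrite -[X in measurable X]setTI; exact: measurable_tuple_cons. Qed.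

Let lebesgue_succ0 : lebesgue_succ set0 = 0%E.
Proof. by rewrite /lebesgue_succ /pushforward preimage_set0 measure0. Qed.

Let lebesgue_succ_ge0 A : (0 <= lebesgue_succ A)%E.
Proof. by rewrite /lebesgue_succ /pushforward measure_ge0. Qed.

Let lebesgue_succ_additive : semi_sigma_additive lebesgue_succ.
Proof.
move=> F mF tF mUF; rewrite /lebesgue_succ /pushforward preimage_bigcup.
apply: measure_semi_sigma_additive.
- by move=> n; exact: pre_measurable.
- apply/trivIsetP => /= i j _ _ ij; rewrite -preimage_setI.
  by move/trivIsetP : tF => /(_ _ _ _ _ ij) ->//; rewrite preimage_set0.
- by rewrite -preimage_bigcup; exact: pre_measurable.
Qed.

HB.instance Definition _ := isMeasure.Build _ _ _ lebesgue_succ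
  lebesgue_succ0 lebesgue_succ_ge0 lebesgue_succ_additive.

Let lebesgue_succ_sigma_finite : sigma_finite setT lebesgue_succ.
Proof.
have [F TF Foo] := lebprod_sigma_finite.
exists (fun n => [set x | F n (thead x, [tuple of behead x])]).
  apply/seteqP; split=> // x _.
  have : (\bigcup_i F i) (thead x, [tuple of behead x]) by rewrite -TF.
  by move=> [n _ Fn]; exists n.
move=> n; have [mF Fnoo] := Foo n; split.
  rewrite -[X in measurable X]setTI.
  apply: (_ : measurable_fun setT (fun x : euclid R d.+1 =>
    (thead x, [tuple of behead x]))) => //.
  apply/measurable_fun_pair; first exact: measurable_tnth.
  exact: measurable_behead.
rewrite /lebesgue_succ /pushforward.
rewrite (_ : _ @^-1` _ = F n)//; apply/seteqP; split=> -[a t] /=;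
  by rewrite theadE (_ : [tuple of _] = t)//; exact/val_inj.
Qed.

HB.instance Definition _ := Measure_isSigmaFinite.Build _ _ _ lebesgue_succ
  lebesgue_succ_sigma_finite.

End succ.

Fixpoint lebesgue_euclid d : {sigma_finite_measure set (euclid R d) -> \bar R} :=
  match d with
  | 0%N => \d_([tuple] : euclid R 0)
  | d'.+1 => lebesgue_succ (lebesgue_euclid d')
  end.

Lemma lebesgue_euclid_box d (A : 'I_d -> set (measurableTypeR R)) :
  (forall i, measurable (A i)) ->
  lebesgue_euclid d [set x | forall i, A i (tnth x i)] =
  (\prod_(i < d) lebesgue_measure (A i))%E.
Proof.
elim: d A => [|d IH] A mA /=.
  by rewrite big_ord0 /dirac indicE mem_set//=; case.
rewrite big_ord_recl /lebesgue_succ /pushforward.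
rewrite (_ : _ @^-1` _ = A ord0 `*`
  [set x | forall i, A (lift ord0 i) (tnth x i)]); last first.
  apply/seteqP; split=> -[a t] /=.
    move=> H; split; first by have := H ord0.
    by move=> i; have := H (lift ord0 i); rewrite tnthS.
  move=> [a0 H] i; case: (unliftP ord0 i) => [j ->|-> //].
  by rewrite tnthS.
rewrite [LHS]product_measure1E//; first by congr (_ * _)%E; exact: IH.
rewrite (_ : [set _ | _] = \bigcap_(i in [set: 'I_d])
   ((fun x : euclid R d => tnth x i) @^-1` A (lift ord0 i))); last first.
  by apply/seteqP; split => x /= H i => [_|]; exact: H.
apply: fin_bigcap_measurable => // i _.
by rewrite -[X in measurable X]setTI; exact: measurable_tnth.
Qed.

End lebesgue_tuple.

(** Measurability is Lebesgue measurability: equality almost everywhere with a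
    Borel function. *)
Definition lebesgue_measurable (R : realType) (d : nat) (f : euclid R d -> R) :
    Prop :=
  exists2 g : euclid R d -> R, measurable_fun [set: euclid R d] g &
    {ae lebesgue_euclid d, forall x, f x = g x}.

Definition lebesgue_measurableC (R : realType) (d : nat)
    (f : euclid R d -> complex R) : Prop :=
  lebesgue_measurable (fun x => complex.Re (f x)) /\
  lebesgue_measurable (fun x => complex.Im (f x)).

(** Compactness is that of the library's topology on row vectors. *)
Definition compact_euclid (R : realType) (d : nat) (K : set (euclid R d)) :
    Prop :=
  compact [set v : 'rV[R]_d | K [tuple v ord0 i | i < d]].

Record weight (R : realType) (d : nat) (sigma : euclid R d -> R) : Prop :=
  Weight {
    weight_measurable : lebesgue_measurable sigma;
    weight_locally_integrable : forall K, compact_euclid K ->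
      (\int[lebesgue_euclid d]_(x in K) `|sigma x|%:E < +oo)%E;
    weight_gt0 : {ae lebesgue_euclid d, forall x, 0 < sigma x} }.

(** sigma(E) as a real number: [\int] in [ring_scope] sends +oo to 0, which is
    harmless on cubes, where weights have finite mass. *)
Definition wmeas (R : realType) (d : nat) (sigma : euclid R d -> R)
    (E : set (euclid R d)) : R :=
  \int[lebesgue_euclid d]_(x in E) sigma x.

(** A cube of sidelength [l] is a product of [d] bounded intervals of length
    [l]; each of them may or may not contain each of its endpoints. *)
Definition is_cube (R : realType) (d : nat) (l : R) (Q : set (euclid R d)) :
    Prop :=
  exists (a : 'I_d -> R) (b c : 'I_d -> bool),
    Q = [set x | forall i, (tnth x i : R) \in
           Interval (BSide (b i) (a i)) (BSide (c i) (a i + l))].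

Record dyadic_grid (R : realType) (d : nat) (D : set (set (euclid R d))) :
    Prop := DyadicGrid {
  grid_cube : forall Q, D Q -> exists k : int, is_cube (2 ^ k) Q;
  grid_nested : forall Q Q', D Q -> D Q' ->
    [\/ Q `&` Q' = Q, Q `&` Q' = Q' | Q `&` Q' = set0];
  grid_partition : forall k : int,
    partition [set Q | D Q /\ is_cube (2 ^ k) Q] id [set: euclid R d] }.

(** The value is +oo when no [l] is admissible. *)
Definition luxnorm (R : realType) (d : nat) (Phi : R -> R)
    (sigma : euclid R d -> R) (f : euclid R d -> complex R) : \bar R :=
  ereal_inf [set l%:E | l in [set l : R | 0 < l /\
    (\int[lebesgue_euclid d]_x
       (Phi (ComplexField.Normc.normc (f x) / l) * sigma x)%:E <= 1)%E]].

Definition orlicz (R : realType) (d : nat) (Phi : R -> R)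
    (sigma : euclid R d -> R) (f : euclid R d -> complex R) : Prop :=
  lebesgue_measurableC f /\ (luxnorm Phi sigma f < +oo)%E.

Definition nu_weight (R : realType) (n d : nat) (Phi : R -> R)
    (Phis : 'I_n -> R -> R) (sigma : 'I_n -> euclid R d -> R)
    (x : euclid R d) : R :=
  (Phi (\prod_(i < n) inv_Rplus (Phis i) (sigma i x)^-1))^-1.

(* Main.v *)
Require Import Defs.
From HB Require Import structures.
From mathcomp Require Import all_boot all_order all_algebra.
From mathcomp Require Import finmap complex.
From mathcomp Require Import all_classical all_reals all_analysis.
From mathcomp Require Import measurable_realfun lra ring.

(** The growth conditions leave little freedom: an element of [class_Utilde] is
    bounded above and below by multiples of a single power [t `^ q]
    ([class_Utildeq_power]), and [nabla_2] forces [1 < q], since otherwise the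
    integral it bounds diverges at the origin ([nabla_2_power_gt1]).
    Consequently [Phi] is comparable to [t `^ r] with [r^-1 = \sum_i (q i)^-1]
    ([prod_inv_power]), the weight [nu] is at most a multiple of
    [\prod_i sigma_i `^ (r / q i)] ([nu_weight_bound]), and [Psi t / t `^ r] is
    almost increasing.

    Normalize the functions, let [a i Q] be the [sigma_i]-average of [f i] over
    [Q], and let [A Q = \prod_i a i Q].  As the sum over the grid is the
    supremum of its finite partial sums, it is enough to bound the sum over a
    finite family [F] of cubes, uniformly in [F]; maximal cubes then exist.
    Let [M] and [M_i] denote the maximal functions of the averages [A] and
    [a i] over the cubes of [F].

    Each [M_i] is bounded on L^(q i)(sigma_i) ([maximal_inequality]): the maximal
    cubes with average above [v] are disjoint, the part of [f i] larger than
    [v / 2] accounts for half of these averages, and summing the resulting weak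
    estimates over the levels [v = eps 2^k] is a geometric sum
    ([sum_level_lt]).  Since [M <= \prod_i M_i] and the exponents [r / q i] add
    up to [1], [prod_powR_le_sum] gives
    [M `^ r * \prod_i sigma_i `^ (r / q i) <= \sum_i M_i `^ q i * sigma_i], and
    the integral of the left-hand side is bounded by a constant depending only
    on the growth functions.

    The embedding ([carleson_embedding]) decomposes the cubes by the levels
    [v] that [A] exceeds.  The cubes of one level lie inside its maximal cubes
    [S], and the packing hypothesis on [S], combined with Chebyshev's
    inequality for [M] and the almost monotonicity of [Psi t / t `^ r], bounds
    [Psi v] times the packed mass by a multiple of [v `^ r] times the measure of
    [S] ([packing_level_bound]).  Summing over the levels reconstructs
    the integral of [M `^ r], by the same geometric sum. *)

Set Implicit Arguments.
Unset Strict Implicit.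
Unset Printing Implicit Defensive.
Import Order.TTheory GRing.Theory Num.Theory.
Import numFieldNormedType.Exports.

Local Open Scope classical_set_scope.
Local Open Scope ring_scope.

(** * Integrals of functions that are not Borel measurable *)

Section nonmeasurable_integral.
Import HBNNSimple.

Lemma ge0_ae_le_integral dT (T : measurableType dT) (R : realType)
    (mu : {measure set T -> \bar R}) (f g : T -> \bar R) :
  (forall x, 0 <= f x)%E -> (forall x, 0 <= g x)%E ->
  {ae mu, forall x, (f x <= g x)%E} ->
  (\int[mu]_x f x <= \int[mu]_x g x)%E.
Proof.
move=> f0 g0 [N [mN N0 fgN]].
rewrite [leLHS]ge0_integralTE// [leRHS]ge0_integralTE//.
apply: ge_ereal_sup => _ [h/= hf <-].
rewrite -integralT_nnsfun.
rewrite (ge0_negligible_integral mN)//; last 2 first.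
- exact/measurable_EFinP.
- by move=> x _; rewrite lee_fin; exact: fun_ge0.
rewrite setTD ge0_integralE; last by move=> x _; rewrite lee_fin; exact: fun_ge0.
apply: le_ereal_sup => _ [k/= kh <-]; exists k => // x.
apply: (le_trans (kh x)); rewrite patchE; case: ifPn => // xN.
apply: (le_trans (hf x)); apply: contrapT => fgx.
by move: xN; rewrite inE; apply; apply: fgN.
Qed.

(** The integral is a supremum of integrals of simple functions below the
    integrand, which a null set does not affect even when the integrand is not
    measurable. *)
Lemma ae_le_integral dT (T : measurableType dT) (R : realType)
    (mu : {measure set T -> \bar R}) (D : set T) (f g : T -> \bar R) :
  {ae mu, forall x, D x -> (f x <= g x)%E} ->
  (\int[mu]_(x in D) f x <= \int[mu]_(x in D) g x)%E.
Proof.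
move=> fg; rewrite !(integral_mkcond D).
have {fg}fg : {ae mu, forall x, ((f \_ D) x <= (g \_ D) x)%E}.
  apply: filterS fg => x fgx; rewrite !patchE.
  by case: ifPn => //; rewrite inE; exact: fgx.
rewrite [leLHS]integralE [leRHS]integralE; apply: leeB.
- apply: ge0_ae_le_integral => //; apply: filterS fg => x fgx.
  by rewrite !funeposE le_max2.
- apply: ge0_ae_le_integral => //; apply: filterS fg => x fgx.
  by rewrite !funenegE le_max2// leeN2.
Qed.

Lemma ae_eq_integralW dT (T : measurableType dT) (R : realType)
    (mu : {measure set T -> \bar R}) (D : set T) (f g : T -> \bar R) :
  {ae mu, forall x, D x -> f x = g x} ->
  (\int[mu]_(x in D) f x = \int[mu]_(x in D) g x)%E.
Proof.
move=> fg; apply/eqP; rewrite eq_le; apply/andP; split;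
  by apply: ae_le_integral; apply: filterS fg => x fgx Dx; rewrite fgx.
Qed.

End nonmeasurable_integral.

(** * Maximal sets and dyadic levels *)

Definition nested (T : Type) (F : seq (set T)) : Prop :=
  forall Q S, Q \in F -> S \in F -> [\/ Q `<=` S, S `<=` Q | Q `&` S = set0].

Definition max_average (R : realType) (T : Type) (F : seq (set T))
    (a : set T -> R) (x : T) : R :=
  \big[Num.max/0]_(Q <- F) (a Q * \1_Q x).

Lemma max_average_ge0 (R : realType) (T : Type) (F : seq (set T))
    (a : set T -> R) x : 0 <= max_average F a x.
Proof. exact: bigmax_ge_id. Qed.

Lemma le_max_average (R : realType) (T : Type) (F : seq (set T))
    (a : set T -> R) Q x : Q \in F -> Q x -> a Q <= max_average F a x.
Proof.
move=> QF Qx; apply: (@le_trans _ _ (a Q * \1_Q x)).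
  by rewrite indicE mem_set// mulr1.
rewrite /max_average; elim: F QF => // S F IH.
rewrite in_cons big_cons le_max => /orP[/eqP->|/IH->]; first by rewrite lexx.
by rewrite orbT.
Qed.

Lemma max_average_attained (R : realType) (T : Type) (F : seq (set T))
    (a : set T -> R) x : 0 < max_average F a x ->
  exists Q, [/\ Q \in F, Q x & max_average F a x = a Q].
Proof.
rewrite /max_average; elim: F => [|Q F IH]; first by rewrite big_nil ltxx.
rewrite big_cons; set m := \big[_/_]_(_ <- _) _ in IH *.
have [|] := leP (a Q * \1_Q x) m.
  move=> _ /IH[S [SF Sx ->]]; exists S; split => //.
  by rewrite in_cons SF orbT.
move=> _; rewrite indicE; case: (boolP (x \in Q)) => [|_]; last first.
  by rewrite mulr0 ltxx.
rewrite inE => Qx _; exists Q; split => //; first by rewrite in_cons eqxx.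
by rewrite mulr1.
Qed.

Lemma measurable_max_average (R : realType) dT (T : measurableType dT)
    (F : seq (set T)) (a : set T -> R) :
  (forall Q, Q \in F -> measurable Q) ->
  measurable_fun [set: T] (max_average F a).
Proof.
elim: F => [|Q F IH] mF.
  rewrite (_ : max_average _ _ = cst 0)//.
  by apply/funext => x; rewrite /max_average big_nil.
rewrite (_ : max_average _ _ =
    (fun x => a Q * \1_Q x) \max max_average F a); last first.
  by apply/funext => x; rewrite /max_average big_cons.
apply: measurable_maxr.
  apply: measurable_funM => //; apply: measurable_indic.
  by apply: mF; rewrite in_cons eqxx.
by apply: IH => S SF; apply: mF; rewrite in_cons SF orbT.
Qed.

(** By induction on the family: a new set is either contained in a member of the
    cover or replaces the members that it contains. *)
Lemma nested_disjoint_cover (R : realType) (T : Type) (F : seq (set T)) :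
  nested F ->
  exists E : seq (set T), [/\ {subset E <= F},
    (forall Q, Q \in F -> exists2 S, S \in E & Q `<=` S) &
    (forall x, \sum_(S <- E) \1_S x <= 1 :> R)].
Proof.
elim: F => [_|Q F IH nF].
  by exists [::]; split => // x; rewrite big_nil.
have [|E [EF FE E1]] := IH.
  by move=> S S' SF SF'; apply: nF; rewrite in_cons ?SF ?SF' orbT.
have [[S [SE QS]]|QE] := pselect (exists S, S \in E /\ Q `<=` S).
  exists E; split => //.
    by move=> S' /EF; rewrite in_cons => ->; rewrite orbT.
  move=> S'; rewrite in_cons => /orP[/eqP->|/FE//].
  by exists S.
exists (Q :: [seq S <- E | ~~ `[< S `<=` Q >]]); split.
- move=> S; rewrite !in_cons mem_filter => /orP[->//|/andP[_ /EF ->]].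
  by rewrite orbT.
- move=> S; rewrite in_cons => /orP[/eqP->|/FE[S' S'E SS']].
    by exists Q; rewrite // in_cons eqxx.
  have [S'Q|S'Q] := pselect (S' `<=` Q).
    by exists Q; [rewrite in_cons eqxx|exact: subset_trans S'Q].
  exists S' => //; rewrite in_cons mem_filter S'E andbT; apply/orP; right.
  exact/asboolPn.
- move=> x; rewrite big_cons big_filter.
  have [Qx|Qx] := pselect (Q x); last first.
    rewrite [\1_Q x]indicE memNset// add0r (le_trans _ (E1 x))//.
    by rewrite [leRHS](bigID (fun S => ~~ `[< S `<=` Q >]))/= lerDl sumr_ge0.
  rewrite [\1_Q x]indicE mem_set// big1_seq ?addr0// => S /andP[/asboolPn SQ SE].
  rewrite indicE memNset// => Sx.
  have [|||//|QS] := nF Q S.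
  - by rewrite in_cons eqxx.
  - by rewrite in_cons EF ?orbT.
  - by move=> QS; apply: QE; exists S.
  - by have : (Q `&` S) x by []; rewrite QS.
Qed.

(** Disjointness of the maximal sets of a level is recorded by the sum of their
    indicators, the form in which it enters the integrals. *)
Lemma level_cover (R : realType) (T : Type) (F : seq (set T))
    (a : set T -> R) (v : R) : nested F -> 0 <= v ->
  exists E : seq (set T), [/\ {subset E <= F},
    (forall S, S \in E -> v < a S),
    (forall Q, Q \in F -> v < a Q -> exists2 S, S \in E & Q `<=` S) &
    (forall x, \sum_(S <- E) \1_S x <= (v < max_average F a x)%R%:R :> R)].
Proof.
move=> nF v0.
have [|E [EF FE E1]] := @nested_disjoint_cover R T [seq Q <- F | v < a Q].
  move=> Q S; rewrite !mem_filter => /andP[_ QF] /andP[_ SF]; exact: nF.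
exists E; split.
- by move=> S /EF; rewrite mem_filter => /andP[].
- by move=> S /EF; rewrite mem_filter => /andP[].
- by move=> Q QF vQ; apply: FE; rewrite mem_filter vQ.
- move=> x; case: (boolP (v < _)) => [_|]; first exact: E1.
  rewrite -leNgt => xv; rewrite big1_seq// => S /EF.
  rewrite mem_filter => /andP[vS SF]; rewrite indicE memNset// => Sx.
  by move: (lt_le_trans vS (le_trans (le_max_average a SF Sx) xv)); rewrite ltxx.
Qed.

Definition level (R : realType) (eps : R) (i : nat) : R := eps * 2 ^+ i.

Lemma level_gt0 (R : realType) (eps : R) i : 0 < eps -> 0 < level eps i.
Proof. by move=> e0; rewrite mulr_gt0// exprn_gt0. Qed.

Lemma levelS (R : realType) (eps : R) i : level eps i.+1 = 2 * level eps i.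
Proof. by rewrite /level exprS mulrCA. Qed.

Lemma level_between (R : realType) (eps t : R) m :
  eps < t -> t <= level eps m ->
  exists2 i : 'I_m, level eps i < t & t <= level eps i.+1.
Proof.
move=> et; elim: m => [|m IH] tm.
  by move: (lt_le_trans et tm); rewrite /level expr0 mulr1 ltxx.
have [/IH[i ? ?]|tm'] := leP t (level eps m); last by exists ord_max.
by exists (widen_ord (leqnSn m) i).
Qed.

Lemma levels_exist (R : realType) (T : Type) (F : seq (set T))
    (a : set T -> R) :
  exists eps m, 0 < eps /\
    forall Q, Q \in F -> 0 < a Q -> eps < a Q <= level eps m.
Proof.
suff [eps [M [e0 M0 H]]] : exists eps M, [/\ 0 < eps, 0 < M &
    forall Q, Q \in F -> 0 < a Q -> eps < a Q <= M].
  exists eps, (Num.trunc (M / eps)).+1; split => // Q QF /(H _ QF)/andP[-> aM] /=.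
  apply: (le_trans aM); rewrite /level mulrC -ler_pdivrMr//.
  apply: (le_trans (ltW (truncnS_gt _))).
  by rewrite -natrX ler_nat ltnW// ltn_expl.
elim: F => [|Q F [eps [M [e0 M0 H]]]]; first by exists 1, 1.
have [aQ|aQ] := ltP 0 (a Q); last first.
  exists eps, M; split => // S; rewrite in_cons => /orP[/eqP->|]; last exact: H.
  by move=> /(le_lt_trans aQ); rewrite ltxx.
exists (Num.min eps (a Q / 2)), (Num.max M (a Q)); split.
- by rewrite lt_min e0 divr_gt0.
- by rewrite lt_max M0.
- move=> S; rewrite in_cons => /orP[/eqP->|SF] aS.
    by rewrite gt_min ltr_pdivrMr// ltr_pMr// ltr1n orbT le_max lexx orbT.
  by have /andP[h1 h2] := H _ SF aS; rewrite gt_min h1 le_max h2.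
Qed.

Lemma sub1_powR2_gt0 (R : realType) (q : R) : 0 < q -> 0 < 1 - 2 `^ (- q) :> R.
Proof.
move=> q0; rewrite subr_gt0 powRN invf_lt1 ?powR_gt0//.
by rewrite /powR pnatr_eq0/= expR_gt1 mulr_gt0// ln_gt0// ltr1n.
Qed.

Lemma sum_level_powR (R : realType) (q eps : R) m : 0 < q -> 0 < eps ->
  (1 - 2 `^ (- q)) * \sum_(i < m) level eps i `^ q <=
    2 `^ (- q) * level eps m `^ q.
Proof.
move=> q0 e0; elim: m => [|m IH].
  by rewrite big_ord0 mulr0 mulr_ge0// powR_ge0.
rewrite big_ord_recr/= mulrDr levelS (powRM _ (ler0n R 2) (ltW (level_gt0 m e0))) mulrA -powRD ?pnatr_eq0 ?implybT//.
rewrite addNr powRr0 mul1r; apply: (le_trans (lerD IH (lexx _))).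
by rewrite -mulrDl addrC subrK mul1r.
Qed.

(** A geometric sum is comparable to its largest term: a power can be
    recovered from the levels that it exceeds. *)
Lemma sum_level_lt (R : realType) (q eps M : R) m : 0 < q -> 0 < eps -> 0 <= M ->
  \sum_(i < m) level eps i `^ q * (level eps i < M)%R%:R <=
    (1 - 2 `^ (- q))^-1 * M `^ q.
Proof.
move=> q0 e0 M0.
have r0 := sub1_powR2_gt0 q0.
rewrite mulrC ler_pdivlMr// mulrC; elim: m => [|m IH].
  by rewrite big_ord0 mulr0 powR_ge0.
have [vM|vM] := ltP (level eps m) M; last first.
  by rewrite big_ord_recr/= ltNge vM mulr0 addr0.
apply: (@le_trans _ _ ((1 - 2 `^ (- q)) * \sum_(i < m.+1) level eps i `^ q)).
  rewrite ler_wpM2l ?(ltW r0)// ler_sum// => i _.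
  by rewrite ler_piMr ?powR_ge0//; case: ltP.
apply: (le_trans (sum_level_powR m.+1 q0 e0)).
rewrite levelS (powRM _ (ler0n R 2) (ltW (level_gt0 m e0))) mulrA -powRD ?pnatr_eq0 ?implybT//.
rewrite addNr powRr0 mul1r ge0_ler_powR// ?nnegrE ?ltW//.
exact: level_gt0.
Qed.

(** * The weighted dyadic maximal inequality *)

Lemma integral_mulr_indic dT (T : measurableType dT) (R : realType)
    (mu : {measure set T -> \bar R}) (S : set T) (g : T -> R) :
  (\int[mu]_(x in S) (g x)%:E = \int[mu]_x (g x * \1_S x)%:E)%E.
Proof.
rewrite integral_mkcond; apply: eq_integral => x _.
by rewrite patchE indicE; case: ifPn => _; rewrite ?mulr1 ?mulr0.
Qed.

Lemma integral_level_sum dT (T : measurableType dT) (R : realType)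
    (mu : {measure set T -> \bar R}) (m : nat) (E : nat -> seq (set T))
    (g : nat -> T -> R) :
  (forall i S, S \in E i -> measurable S) ->
  (forall i, measurable_fun [set: T] (g i)) ->
  (forall i x, 0 <= g i x) ->
  (\int[mu]_x (\sum_(i < m) \sum_(S <- E i) g i x * \1_S x)%:E =
   \sum_(i < m) \sum_(S <- E i) \int[mu]_(x in S) (g i x)%:E)%E.
Proof.
move=> mE mg g0.
under eq_integral do rewrite -sumEFin.
have mgS i S : S \in E i -> measurable_fun [set: T] (fun x => g i x * \1_S x).
  by move=> SE; apply: measurable_funM => //; apply: measurable_indic; exact: mE SE.
have gS0 i S x : 0 <= g i x * \1_S x by rewrite mulr_ge0.
rewrite ge0_integral_sum//=; last 2 first.
- move=> i; apply/measurable_EFinP; under eq_fun do rewrite big_seq.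
  rewrite (_ : (fun x => _) = (fun x => \sum_(S <- E i)
      (if S \in E i then g i x * \1_S x else 0))); last first.
    by apply/funext => x; rewrite big_mkcond.
  by apply: measurable_sum => S; case: (boolP (S \in E i)) => // /mgS.
- by move=> i x _; rewrite lee_fin sumr_ge0.
apply: eq_bigr => i _; under eq_integral do rewrite -sumEFin big_seq big_mkcond.
rewrite [RHS]big_seq [RHS]big_mkcond ge0_integral_sum//=.
- apply: eq_bigr => S _; case: ifPn => SE; last by rewrite integral0.
  exact/esym/integral_mulr_indic.
- by move=> S; case: (boolP (S \in E i)) => // SE; apply/measurable_EFinP; exact: mgS.
- by move=> S x _; case: ifPn => // SE; rewrite lee_fin.
Qed.

(** Where [f] is at most [v / 2] it cannot account for more than half of an
    average of at least [v], so the large values of [f] carry the other half. *)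
Lemma average_truncation dT (T : measurableType dT) (R : realType)
    (mu : {measure set T -> \bar R}) (S : set T) (w f : T -> R) (v : R) :
  measurable S -> measurable_fun [set: T] w -> measurable_fun [set: T] f ->
  (forall x, 0 <= w x) -> (forall x, 0 <= f x) -> 0 <= v ->
  (\int[mu]_(x in S) (w x)%:E < +oo)%E ->
  (v%:E * \int[mu]_(x in S) (w x)%:E <=
     \int[mu]_(x in S) (f x * w x)%:E)%E ->
  (v%:E * \int[mu]_(x in S) (w x)%:E <=
     2%:E * \int[mu]_(x in S) ((if (v < 2 * f x)%R then f x else 0) * w x)%:E)%E.
Proof.
move=> mS mw mf w0 f0 v0 Woo.
set W := (\int[mu]_(x in S) (w x)%:E)%E in Woo *.
have W0 : (0 <= W)%E by apply: integral_ge0 => x _; rewrite lee_fin.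
set f1 := fun x => if (v < 2 * f x)%R then f x else 0.
have mf1 : measurable_fun [set: T] f1.
  apply: measurable_fun_ifT => //.
  by apply: measurable_fun_ltr => //; exact: measurable_funM.
have f10 x : 0 <= f1 x by rewrite /f1; case: ifP.
have I0 : (0 <= \int[mu]_(x in S) (f1 x * w x)%:E)%E.
  by apply: integral_ge0 => x _; rewrite lee_fin mulr_ge0.
move=> H.
have : (v%:E * W <= \int[mu]_(x in S) (f1 x * w x)%:E + (v / 2)%:E * W)%E.
  apply: (le_trans H).
  rewrite -ge0_integralZl//; last 3 first.
  - by apply/measurable_EFinP; exact: measurable_funTS.
  - by move=> x _; rewrite lee_fin.
  - by rewrite lee_fin divr_ge0.
  rewrite -ge0_integralD//; last 4 first.
  - by move=> x _; rewrite lee_fin mulr_ge0.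
  - by apply/measurable_EFinP/measurable_funTS; exact: measurable_funM.
  - by move=> x _; rewrite -EFinM lee_fin mulr_ge0// divr_ge0.
  - by apply/measurable_EFinP/measurable_funTS; exact: measurable_funM.
  apply: ae_le_integral; apply: aeW => x _ /=.
  rewrite -EFinM -EFinD lee_fin -mulrDl ler_wpM2r// /f1.
  case: ltP => fv; first by rewrite lerDl divr_ge0.
  by rewrite add0r ler_pdivlMr// mulrC.
rewrite -/f1 => {H}; clearbody W; move: Woo W0; case: W => [r _ r0| |]//.
move: I0; case: (\int[mu]_(x in S) (f1 x * w x)%:E)%E => [s s0| |]//; last first.
  by move=> _ _; rewrite gt0_muley ?leey// lte_fin.
rewrite -!EFinM -EFinD !lee_fin; lra.
Qed.

(** Naming the bound lets one constant be chosen for each exponent before the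
    measure space, the sets and the functions are given. *)
Definition maximal_bound (R : realType) (p C : R) : Prop :=
  forall dT (T : measurableType dT) (mu : {measure set T -> \bar R})
    (F : seq (set T)) (a : set T -> R) (w f : T -> R),
  nested F -> (forall Q, Q \in F -> measurable Q) ->
  measurable_fun [set: T] w -> measurable_fun [set: T] f ->
  (forall x, 0 <= w x) -> (forall x, 0 <= f x) ->
  (forall Q, Q \in F -> 0 < a Q ->
     (\int[mu]_(x in Q) (w x)%:E < +oo)%E /\
     ((a Q)%:E * \int[mu]_(x in Q) (w x)%:E <=
        \int[mu]_(x in Q) (f x * w x)%:E)%E) ->
  (\int[mu]_x (max_average F a x `^ p * w x)%:E <=
     C%:E * \int[mu]_x (f x `^ p * w x)%:E)%E.

(** The constant comes from integrating the truncated weak estimate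
    [average_truncation] over the levels: the powers of the levels below
    [2 * f x] sum to a multiple of [f x `^ (p - 1)]. *)
Lemma maximal_inequality (R : realType) (p : R) : 1 < p ->
  exists C : R, 0 < C /\ maximal_bound p C.
Proof.
move=> p1; have p0 : 0 < p by exact: lt_trans p1.
have p10 : 0 < p - 1 by rewrite subr_gt0.
set K := (1 - 2 `^ (- (p - 1)))^-1 : R.
have K0 : 0 < K by rewrite invr_gt0 sub1_powR2_gt0.
exists (2 `^ p * 2 * K * 2 `^ (p - 1)).
split; first by rewrite !mulr_gt0// ?powR_gt0.
move=> dT T mu F a w f nF mF mw mf w0 f0 aF.
have [eps [m [e0 levF]]] := levels_exist F a.
have v0 i : 0 < level eps i by exact: level_gt0.
have [E EP] := choice (fun i => level_cover a nF (ltW (v0 i))).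
pose f1 i x := if (level eps i < 2 * f x)%R then f x else 0.
have mf1 i : measurable_fun [set: T] (f1 i).
  apply: measurable_fun_ifT => //.
  by apply: measurable_fun_ltr => //; exact: measurable_funM.
have f10 i x : 0 <= f1 i x by rewrite /f1; case: ifP.
have mE i S : S \in E i -> measurable S.
  by have [EF _ _ _] := EP i; move=> /EF; exact: mF.
pose c i := level eps i.+1 `^ p.
have c0 i : 0 <= c i by exact: powR_ge0.
apply: (@le_trans _ _ (\int[mu]_x
    (\sum_(i < m) \sum_(S <- E i) (c i * w x) * \1_S x)%:E)%E).
  apply: ae_le_integral; apply: aeW => x _; rewrite lee_fin.
  have s0 i : 0 <= \sum_(S <- E i) c i * w x * \1_S x.
    by apply: sumr_ge0 => S _; rewrite !mulr_ge0.
  have := max_average_ge0 F a x; rewrite le_eqVlt => /orP[/eqP <-|M0].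
    by rewrite powR0 ?gt_eqF// mul0r sumr_ge0.
  have [Q [QF Qx MQ]] := max_average_attained M0.
  have aQ0 : 0 < a Q by rewrite -MQ.
  have /andP[eQ Qm] := levF _ QF aQ0.
  have [i iQ Qi] := level_between eQ Qm.
  have [_ _ /(_ _ QF iQ)[S SE QS] _] := EP i.
  rewrite (bigD1 i)//= (le_trans _ (_ : \sum_(S <- E i) c i * w x * \1_S x <= _))//; last first.
    by rewrite lerDl sumr_ge0.
  rewrite (big_rem S)//= (le_trans _ (_ : c i * w x * \1_S x <= _))//; last first.
    by rewrite lerDl sumr_ge0// => S' _; rewrite !mulr_ge0.
  rewrite indicE mem_set; last exact: QS.
  rewrite mulr1 ler_wpM2r// MQ.
  by apply: ge0_ler_powR => //; rewrite ?nnegrE ltW.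
rewrite (@integral_level_sum _ _ _ mu m E (fun i x => c i * w x)); last 3 first.
- exact: mE.
- by move=> i; exact: measurable_funM.
- by move=> i x; rewrite mulr_ge0.
pose g i x := c i * (2 / level eps i) * (f1 i x * w x).
have g0 i x : 0 <= g i x by rewrite !mulr_ge0// invr_ge0 ltW.
have mg i : measurable_fun [set: T] (g i).
  by apply: measurable_funM => //; exact: measurable_funM.
apply: (@le_trans _ _
    (\sum_(i < m) \sum_(S <- E i) \int[mu]_(x in S) (g i x)%:E)%E).
  apply: lee_sum => i _; rewrite big_seq [leRHS]big_seq; apply: lee_sum => S SE.
  have [EF vS _ _] := EP i.
  have [Woo aS] := aF _ (EF _ SE) (lt_trans (v0 i) (vS _ SE)).
  have W0 : (0 <= \int[mu]_(x in S) (w x)%:E)%E.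
    by apply: integral_ge0 => x _; rewrite lee_fin.
  have := average_truncation (mE _ _ SE) mw mf w0 f0 (ltW (v0 i)) Woo.
  move=> /(_ (le_trans (lee_wpmul2r W0 _) aS)).
  rewrite lee_fin => /(_ (ltW (vS _ SE))) trunc.
  under eq_integral do rewrite EFinM.
  rewrite ge0_integralZl//; last 4 first.
  - exact: mE SE.
  - by apply/measurable_EFinP; exact: measurable_funTS.
  - by move=> x _; rewrite lee_fin.
  - by rewrite lee_fin.
  rewrite [leRHS](_ : _ = ((c i)%:E * ((level eps i)^-1%:E * (2%:E *
      \int[mu]_(x in S) (f1 i x * w x)%:E)))%E); last first.
    under eq_integral do rewrite /g EFinM.
    rewrite ge0_integralZl//; last 4 first.
    - exact: mE SE.
    - by apply/measurable_EFinP/measurable_funTS; exact: measurable_funM.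
    - by move=> x _; rewrite lee_fin mulr_ge0.
    - by rewrite lee_fin !mulr_ge0// invr_ge0 ltW.
    by rewrite !muleA -!EFinM -mulrA (mulrC 2).
  rewrite lee_wpmul2l ?lee_fin// -[leLHS]mul1e -[1%E](_ : ((level eps i)^-1 * level eps i)%:E = _).
    by rewrite EFinM -muleA lee_wpmul2l// lee_fin invr_ge0 ltW.
  by rewrite mulVf// gt_eqF.
rewrite -(@integral_level_sum _ _ _ mu m E g)//.
have mfp : measurable_fun [set: T] (fun x => f x `^ p * w x).
  by apply: measurable_funM => //; exact: (measurableT_comp (measurable_powR p) mf).
rewrite -ge0_integralZl//; last 3 first.
- exact/measurable_EFinP.
- by move=> x _; rewrite lee_fin mulr_ge0// powR_ge0.
- by rewrite lee_fin !mulr_ge0// ?powR_ge0 ?ltW.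
apply: ae_le_integral; apply: aeW => x _; rewrite -EFinM lee_fin.
apply: (@le_trans _ _ (\sum_(i < m) 2 `^ p * 2 * (f x * w x) *
    (level eps i `^ (p - 1) * (level eps i < 2 * f x)%R%:R))).
  apply: ler_sum => i _; rewrite -mulr_sumr.
  have [_ _ _ /(_ x) Ex] := EP i.
  apply: (@le_trans _ _ (g i x)).
    by rewrite ler_piMr// (le_trans Ex)//; case: ltP.
  rewrite /g /f1; case: ifP => _; last by rewrite !(mul0r, mulr0).
  rewrite mulr1 /c levelS (powRM _ (ler0n R 2) (ltW (v0 i))).
  rewrite powRB ?gt_eqF ?implybT// powRr1 ?(ltW (v0 i))//.
  by rewrite le_eqVlt; apply/orP; left; apply/eqP; ring.
rewrite -mulr_sumr.
have fw0 : 0 <= 2 `^ p * 2 * (f x * w x) by rewrite !mulr_ge0 ?powR_ge0.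
apply: (le_trans (ler_wpM2l fw0 (sum_level_lt _ p10 e0 _))).
  by rewrite mulr_ge0.
rewrite -/K powRM// -(mulr_powRB1 (f0 x) p0).
by rewrite le_eqVlt; apply/orP; left; apply/eqP; ring.
Qed.

(** * Growth functions comparable to powers *)

Lemma growth_at0 (R : realType) (Phi : R -> R) :
  growth_function Phi -> Phi 0 = 0.
Proof.
move=> G; have [|t t0 Pt] := growth_surj G (_ : Rplus 0).
  by rewrite /Rplus/= in_itv/= lexx.
move: t0; rewrite /Rplus/= in_itv/= andbT => t0.
apply/eqP; rewrite eq_le growth_ge0// andbT -{2}Pt.
exact: growth_nondecreasing.
Qed.

Lemma class_U_gt0 (R : realType) (Phi : R -> R) t :
  class_U Phi -> 0 < t -> 0 < Phi t.
Proof.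
move=> [q _ [G [_ [C C0 HC]] _]] t0.
rewrite lt_neqAle growth_ge0 ?ltW// andbT; apply/eqP => Pt0.
have [s s0 /eqP[]] := growth_neq0 G.
apply/eqP; rewrite eq_le growth_ge0// andbT.
apply: (@le_trans _ _ (Phi (t * Num.max 1 (s / t)))).
  apply: growth_nondecreasing => //.
  by rewrite mulrC -ler_pdivrMr// le_max lexx orbT.
by rewrite (le_trans (HC _ _ _ _))// -?Pt0 ?mulr0// le_max lexx.
Qed.

Lemma class_U_surj (R : realType) (Phi : R -> R) :
  class_U Phi -> set_surj Rplus Rplus Phi.
Proof. by move=> [q _ [/growth_surj]]. Qed.

Lemma inv_Rplus_ge0 (R : realType) (Phi : R -> R) y :
  set_surj Rplus Rplus Phi -> 0 <= y -> 0 <= inv_Rplus Phi y.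
Proof.
move=> sPhi y0.
have /(_ (inv_Rplus Phi y)) := @surjpinv_image_sub _ _ (fun=> point) _ _ _ sPhi.
rewrite /Rplus/= in_itv/= andbT; apply.
by exists y => //; rewrite in_itv/= y0.
Qed.

Lemma inv_RplusK (R : realType) (Phi : R -> R) y :
  set_surj Rplus Rplus Phi -> 0 <= y -> Phi (inv_Rplus Phi y) = y.
Proof.
by move=> sPhi y0; rewrite /inv_Rplus (surjpK _ sPhi)// inE /Rplus/= in_itv/= y0.
Qed.

Lemma class_U_inv0 (R : realType) (Phi : R -> R) :
  class_U Phi -> inv_Rplus Phi 0 = 0.
Proof.
move=> UPhi; have sPhi := class_U_surj UPhi.
apply/eqP; rewrite eq_le inv_Rplus_ge0// andbT leNgt; apply/negP.
by move=> /(class_U_gt0 UPhi); rewrite inv_RplusK// ltxx.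
Qed.

(** Taking [s = 1] and [s = t] in the two growth bounds of the class pins
    [Phi t] between multiples of the same power on both sides of [1]. *)
Lemma class_Utildeq_power (R : realType) (q : R) (Phi : R -> R) :
  1 <= q -> class_Utildeq q Phi ->
  exists2 kappa, 0 < kappa &
    forall t, 0 < t -> Phi t <= kappa * t `^ q /\ t `^ q <= kappa * Phi t.
Proof.
move=> q1 [Uq _ [C2 C20 H2]].
have UPhi : class_U Phi by exists q.
have P1 : 0 < Phi 1 := class_U_gt0 UPhi ltr01.
have [_ [_ [C1 C10 H1]] _] := Uq.
have CP : 0 < (C1 + C2) * Phi 1 by rewrite mulr_gt0// addr_gt0.
have CV : 0 < (C1 + C2) / Phi 1 by rewrite divr_gt0// addr_gt0.
exists ((C1 + C2) * Phi 1 + (C1 + C2) / Phi 1); first exact: addr_gt0.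
move=> t t0; have tq0 : 0 < t `^ q by exact: powR_gt0.
have Pt : 0 <= Phi t := ltW (class_U_gt0 UPhi t0).
have [tq P1' t0' C1' C2'] : [/\ 0 <= t `^ q, 0 <= Phi 1, 0 <= t, 0 <= C1 & 0 <= C2].
  by split; exact: ltW.
have tVq : t^-1 `^ q = (t `^ q)^-1.
  by rewrite -powRN -[t^-1]powR_inv1// -powRrM mulN1r.
have up : Phi t <= (C1 + C2) * Phi 1 * t `^ q.
  have [t1|/ltW t1] := leP 1 t.
    have := H1 1 t ltr01 t1; rewrite mul1r => /le_trans; apply.
    by rewrite mulrAC ler_wpM2r// ler_wpM2r// lerDl.
  have := H2 1 t^-1 (lexx _); rewrite invf_ge1// => /(_ t1).
  rewrite div1r invrK => /le_trans; apply.
  by rewrite tVq invrK mulrA ler_wpM2r// ler_wpM2r// lerDr.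
have low : t `^ q <= (C1 + C2) / Phi 1 * Phi t.
  rewrite mulrAC ler_pdivlMr// mulrC -ler_pdivlMr//.
  have [t1|/ltW t1] := leP 1 t.
    have := H2 t t t1 t1; rewrite divff ?gt_eqF// => /le_trans; apply.
    by rewrite mulrA ler_wpM2r ?invr_ge0// ler_wpM2r// lerDr.
  have := H1 t t^-1 t0; rewrite invf_ge1// => /(_ t1).
  rewrite divff ?gt_eqF// tVq mulrAC => /le_trans; apply.
  by rewrite ler_wpM2r ?invr_ge0// ler_wpM2r// lerDl.
split.
  by rewrite (le_trans up)// ler_wpM2r// lerDl ltW.
by rewrite (le_trans low)// ler_wpM2r// lerDr ltW.
Qed.

(** If [q <= 1], then [Phi t / t ^+ 2] dominates a multiple of [t^-1] near the
    origin, and the integral in [nabla_2] diverges: the function [t^-1] is at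
    least half the sum of the functions equal to [2 ^+ i] on [`]0, 2 ^- i[],
    each of integral [1]. *)
Lemma nabla_2_power_gt1 (R : realType) (q kappa : R) (Phi : R -> R) :
  0 < kappa -> nabla_2 Phi -> (forall t, 0 < t -> t `^ q <= kappa * Phi t) ->
  1 < q.
Proof.
move=> k0 [_ _ _ [C C0 /(_ 1 ltr01)]]; rewrite divr1 => HC low.
rewrite ltNge; apply/negP => q1.
suff bnd m : m%:R <= 2 * kappa * (C * Phi 1).
  have := bnd (Num.trunc (2 * kappa * (C * Phi 1))).+1.
  by rewrite leNgt truncnS_gt.
pose E i := [:: (`]0, 2 ^- i[%classic : set R)].
pose g i (x : R) := (2 * kappa)^-1 * 2 ^+ i : R.
have := @integral_level_sum _ _ _ (@lebesgue_measure R) m E g.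
move=> /(_ _ _ _) H.
have : (\int[@lebesgue_measure R]_x
    (\sum_(i < m) \sum_(S <- E i) g i x * \1_S x)%:E <= (C * Phi 1)%:E)%E.
  apply: le_trans HC; rewrite [leRHS]integral_mkcond.
  apply: ae_le_integral; apply: aeW => x _; rewrite patchE /g.
  under eq_bigr do rewrite big_seq1.
  case: ifPn => [|/negP]; rewrite inE/= in_itv/= => x01; last first.
    rewrite lee_fin big1// => i _; rewrite indicE memNset ?mulr0//= in_itv/=.
    move=> /andP[x0 xi]; apply: x01; rewrite x0 (le_trans (ltW xi))//.
    by rewrite invf_le1 ?exprn_gt0// exprn_ege1// ler1n.
  have /andP[x0 x1] := x01; rewrite lee_fin.
  have := @sum_level_lt R 1 1 x^-1 m ltr01 ltr01; rewrite invr_ge0 (ltW x0).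
  move=> /(_ isT); rewrite powRN (powRr1 (ler0n _ 2)) (powRr1) ?invr_ge0 ?(ltW x0)// => sumle.
  apply: (@le_trans _ _ ((2 * kappa)^-1 * (2 * x^-1))).
    under eq_bigr do rewrite -mulrA; rewrite -mulr_sumr ler_wpM2l//.
      by rewrite invr_ge0 mulr_ge0// ltW.
    rewrite [leRHS](_ : _ = (1 - 2^-1)^-1 * x^-1); last first.
      by congr (_ * _); rewrite -[LHS]invrK; congr (_^-1); lra.
    apply: le_trans sumle; apply: ler_sum => i _.
    rewrite /level mul1r powRr1 ?exprn_ge0// ler_wpM2l ?exprn_ge0//.
    rewrite indicE; have [ix|xi] := ltP (2 ^+ i) x^-1; first by case: (_ \in _).
    rewrite memNset//= in_itv/= => /andP[_ ix].
    by move: xi; rewrite leNgt => /negP; apply; rewrite -[ltLHS]invrK ltf_pV2 ?posrE ?invr_gt0 ?exprn_gt0.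
  have := low x x0; rewrite -ler_pdivrMl// => lowx.
  rewrite ler_pdivlMr ?exprn_gt0//; apply: le_trans lowx.
  rewrite (_ : _ * _ * _ = kappa^-1 * x); last first.
    by field; rewrite !gt_eqF.
  rewrite ler_pM2l ?invr_gt0//.
  by rewrite ger1_powR// x0.
rewrite H.
- under eq_bigr => i _.
    rewrite big_seq1 /g integral_cst//= lebesgue_measure_itv/= lte_fin.
    rewrite invr_gt0 exprn_gt0// oppr0 addr0 -EFinM mulfK ?gt_eqF ?exprn_gt0//.
    over.
  rewrite sumEFin lee_fin sumr_const card_ord -[_ *+ m]mulr_natr.
  by rewrite mulrC ler_pdivrMr ?mulr_gt0// [X in _ <= X -> _]mulrC.
- by move=> i S; rewrite /E mem_seq1 => /eqP ->.
- by move=> i; exact: measurable_cst.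
- by move=> i x; rewrite mulr_ge0 ?invr_ge0 ?mulr_ge0 ?exprn_ge0// ltW.
Qed.

Lemma ler_powR_inv (R : realType) (q x y : R) : 0 < q -> 0 <= x -> 0 <= y ->
  (x `^ q <= y) = (x <= y `^ q^-1).
Proof.
move=> q0 x0 y0; have qV0 : 0 < q^-1 by rewrite invr_gt0.
have xE : x = (x `^ q) `^ q^-1 by rewrite -powRrM divff ?gt_eqF// powRr1.
have yE : y = (y `^ q^-1) `^ q by rewrite -powRrM mulVf ?gt_eqF// powRr1.
apply/idP/idP => h.
  by rewrite xE ge0_ler_powR ?nnegrE ?powR_ge0// ltW.
by rewrite yE ge0_ler_powR ?nnegrE ?powR_ge0// ltW.
Qed.

Lemma prod_powR (R : realType) (I : Type) (s : seq I) (y : R) (e : I -> R) :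
  0 < y -> \prod_(i <- s) y `^ e i = y `^ (\sum_(i <- s) e i).
Proof.
move=> y0; elim: s => [|i s IH]; first by rewrite !big_nil powRr0.
by rewrite !big_cons IH powRD// (gt_eqF y0) implybT.
Qed.

Lemma powR_prod (R : realType) (I : Type) (s : seq I) (F : I -> R) (q : R) :
  (forall i, 0 <= F i) ->
  (\prod_(i <- s) F i) `^ q = \prod_(i <- s) F i `^ q.
Proof.
move=> F0; elim: s => [|i s IH]; first by rewrite !big_nil powR1.
by rewrite !big_cons powRM ?IH// prodr_ge0.
Qed.

Lemma inv_Rplus_power (R : realType) (q kappa : R) (Phi : R -> R) :
  0 < q -> 0 < kappa -> class_U Phi ->
  (forall t, 0 < t -> Phi t <= kappa * t `^ q /\ t `^ q <= kappa * Phi t) ->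
  forall y, 0 < y ->
    [/\ 0 < inv_Rplus Phi y,
        y `^ q^-1 <= kappa `^ q^-1 * inv_Rplus Phi y &
        inv_Rplus Phi y <= kappa `^ q^-1 * y `^ q^-1].
Proof.
move=> q0 k0 UPhi pow y y0; have sPhi := class_U_surj UPhi.
have [k0' y0'] : 0 <= kappa /\ 0 <= y by split; exact: ltW.
set s := inv_Rplus Phi y.
have sK : Phi s = y by rewrite inv_RplusK.
have s0 : 0 < s.
  rewrite lt_neqAle inv_Rplus_ge0// andbT; apply/eqP => s0.
  move: sK y0; rewrite -s0 => <-; have [q' _ [G _ _]] := UPhi.
  by rewrite growth_at0// ltxx.
have [up low] := pow s s0; rewrite sK in up low; split => //.
  have qV0 : 0 <= q^-1 by rewrite invr_ge0 ltW.
  rewrite [leRHS](_ : _ = (kappa * s `^ q) `^ q^-1).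
    by rewrite ge0_ler_powR ?nnegrE// mulr_ge0// powR_ge0.
  by rewrite powRM ?powR_ge0// -powRrM divff ?gt_eqF// powRr1// ltW.
by rewrite -powRM// -ler_powR_inv// ?mulr_ge0// ltW.
Qed.

(** Comparability with powers passes to the function whose inverse is the
    product of the inverses, the exponents adding harmonically. *)
Lemma prod_inv_power (R : realType) (n : nat) (Phis : 'I_n -> R -> R)
    (Phi : R -> R) (q : 'I_n -> R) (kappa : 'I_n -> R) :
  (0 < n)%N -> (forall i, 0 < q i) -> (forall i, 0 < kappa i) ->
  (forall i, class_U (Phis i)) ->
  (forall i t, 0 < t ->
     Phis i t <= kappa i * t `^ q i /\ t `^ q i <= kappa i * Phis i t) ->
  set_bij Rplus Rplus Phi ->
  (forall y, 0 <= y ->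
     inv_Rplus Phi y = \prod_(i < n) inv_Rplus (Phis i) y) ->
  let r := (\sum_(i < n) (q i)^-1)^-1 in
  exists2 c, 0 < c &
    (forall y, 0 < y -> y `^ r^-1 <= c * inv_Rplus Phi y) /\
    (forall t, 0 < t ->
       [/\ 0 < Phi t, Phi t <= c * t `^ r & t `^ r <= c * Phi t]).
Proof.
move=> n0 q0 k0 UPhi pow bPhi hinv r.
have r0 : 0 < r.
  rewrite invr_gt0 (bigD1 (Ordinal n0))//= ltr_pwDl// ?invr_gt0//.
  by rewrite sumr_ge0// => i _; rewrite invr_ge0 ltW.
set c := \prod_(i < n) kappa i `^ (q i)^-1.
have c0 : 0 < c by apply: prodr_gt0 => i _; rewrite powR_gt0.
have c0' := ltW c0.
have ipow i := inv_Rplus_power (q0 i) (k0 i) (UPhi i) (pow i).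
have invP y : 0 < y -> [/\ 0 < inv_Rplus Phi y,
    y `^ r^-1 <= c * inv_Rplus Phi y & inv_Rplus Phi y <= c * y `^ r^-1].
  move=> y0; rewrite hinv ?(ltW y0)// /r invrK -prod_powR// -!big_split/=; split.
  - by apply: prodr_gt0 => i _; have [] := ipow i y y0.
  - by apply: ler_prod => i _; rewrite powR_ge0; have [] := ipow i y y0.
  - by apply: ler_prod => i _; have [/ltW-> _ ->] := ipow i y y0.
have PhiV t : 0 < t -> 0 < Phi t /\ inv_Rplus Phi (Phi t) = t.
  move=> t0; have tp : Rplus t by rewrite /Rplus/= in_itv/= ltW.
  have [fun_Phi inj_Phi _] := bPhi.
  have tK : inv_Rplus Phi (Phi t) = t.
    by rewrite /inv_Rplus pinvKV// inE.
  split=> //; have := fun_Phi _ tp; rewrite /Rplus/= in_itv/= andbT.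
  rewrite le_eqVlt => /orP[/eqP P0|//]; move: t0; rewrite -tK -P0 hinv//.
  by rewrite (bigD1 (Ordinal n0))//= class_U_inv0// mul0r ltxx.
exists (c + c `^ r); first by rewrite addr_gt0// powR_gt0.
split=> [y y0|t t0].
  have [i0 le _] := invP y y0; rewrite (le_trans le)// ler_wpM2r ?(ltW i0)//.
  by rewrite lerDl powR_ge0.
have [P0 tK] := PhiV t t0; have [_] := invP _ P0; rewrite tK => le1 le2.
have [t0' P0'] : 0 <= t /\ 0 <= Phi t by split; exact: ltW.
have up : Phi t <= c `^ r * t `^ r.
  by rewrite -powRM// -[r in leRHS]invrK -ler_powR_inv ?mulr_ge0// invr_gt0.
have low : t `^ r <= c `^ r * Phi t.
  rewrite ler_powR_inv// ?mulr_ge0 ?powR_ge0// powRM ?powR_ge0//.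
  by rewrite -powRrM divff ?gt_eqF// powRr1.
split => //.
  by rewrite (le_trans up)// ler_wpM2r ?powR_ge0// lerDr.
by rewrite (le_trans low)// ler_wpM2r// lerDr.
Qed.

(** The reciprocal of [Psi (inv_Rplus Phi m^-1)] is the packing bound for a cube
    of [nu]-measure [m], and [N] is the integral over the cube of the product
    of powers of the weights that controls [nu].  The hypothesis
    [s `^ r * N <= K0] makes [s] at most a multiple of [inv_Rplus Phi m^-1], so
    the almost monotonicity of [Psi t / t `^ r] allows [s] to replace this
    argument. *)
Lemma packing_level_bound (R : realType) (r c K0 K1 : R) (Phi Psi : R -> R) :
  0 < r -> 0 < c -> 0 < K0 -> 0 < K1 -> class_U Psi ->
  inv_Rplus Phi 0 = 0 ->
  (forall y, 0 < y -> y `^ r^-1 <= c * inv_Rplus Phi y) ->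
  (forall t, 0 < t ->
       [/\ 0 < Phi t, Phi t <= c * t `^ r & t `^ r <= c * Phi t]) ->
  (forall s t, 0 < s -> s <= t -> Psi s / Phi s <= Psi t / Phi t) ->
  exists2 K, 0 < K & forall s m N : R, 0 < s -> 0 <= m -> m <= K1 * N ->
    s `^ r * N <= K0 ->
    Psi s * (Psi (inv_Rplus Phi m^-1))^-1 <= K * (s `^ r * N).
Proof.
move=> r0 c0 K00 K10 UPsi inv0 invP PhiP mono.
have Psi0 : Psi 0 = 0 by case: UPsi => q _ [/growth_at0].
have [qP _ [_ [qP0 [CP CP0 HP]] _]] := UPsi.
have almost s t : 0 < s -> s <= t -> Psi s / s `^ r <= c ^+ 2 * (Psi t / t `^ r).
  move=> s0 st; have t0 := lt_le_trans s0 st.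
  have [Ps ups _] := PhiP _ s0; have [Pt _ lowt] := PhiP _ t0.
  have [sr tr] : 0 < s `^ r /\ 0 < t `^ r by rewrite !powR_gt0.
  have [Ss St] := (class_U_gt0 UPsi s0, class_U_gt0 UPsi t0).
  have H := mono s t s0 st.
  have h1 : Psi s / s `^ r <= c * (Psi s / Phi s).
    rewrite ler_pdivrMr// (_ : _ * _ * _ = Psi s * (c * s `^ r / Phi s)); last by ring.
    by rewrite ler_peMr ?(ltW Ss)// ler_pdivlMr// mul1r.
  have h2 : Psi t / Phi t <= c * (Psi t / t `^ r).
    rewrite ler_pdivrMr// (_ : _ * _ * _ = Psi t * (c * Phi t / t `^ r)); last by ring.
    by rewrite ler_peMr ?(ltW St)// ler_pdivlMr// mul1r.
  by rewrite (le_trans h1)// expr2 -mulrA ler_pM2l// (le_trans H).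
(* The largest possible ratio of [s] to [inv_Rplus Phi m^-1], kept at least [1]
   so that the upper type of [Psi] applies to it. *)
pose b := Num.max 1 ((K0 * K1 * c `^ r) `^ r^-1).
have b1 : 1 <= b by rewrite le_max lexx.
have b0 : 0 < b := lt_le_trans ltr01 b1.
have cr0 : 0 < c `^ r by rewrite powR_gt0.
set D := c ^+ 2 * (CP * b `^ qP).
have D0 : 0 < D by rewrite !mulr_gt0 ?exprn_gt0 ?powR_gt0.
exists (D * (K1 * c `^ r)); first by apply: mulr_gt0 => //; exact: mulr_gt0.
move=> s m N s0; rewrite le_eqVlt => /orP[/eqP<-|m0] mN sN.
  rewrite invr0 inv0 Psi0 invr0 mulr0.
  rewrite !mulr_ge0 ?powR_ge0//; try exact: ltW.
  by move: mN; rewrite pmulr_rge0.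
have N0 : 0 < N by rewrite -(pmulr_rgt0 _ K10) (lt_le_trans m0).
have mV0 : 0 < m^-1 by rewrite invr_gt0.
have := invP _ mV0; set t := inv_Rplus Phi m^-1 => mt.
have t0 : 0 < t by rewrite -(pmulr_rgt0 _ c0) (lt_le_trans _ mt)// powR_gt0.
have [t0' s0' c0'] : [/\ 0 <= t, 0 <= s & 0 <= c] by split; exact: ltW.
have [sr tr] : 0 < s `^ r /\ 0 < t `^ r by rewrite !powR_gt0.
have one : 1 <= K1 * N * (c `^ r * t `^ r).
  have : m^-1 <= c `^ r * t `^ r.
    rewrite -powRM// -[r in leRHS]invrK -ler_powR_inv ?invr_gt0 ?mulr_ge0//.
    exact: ltW.
  rewrite -(ler_pM2l m0 m^-1) mulfV ?gt_eqF// => /le_trans; apply.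
  by rewrite ler_wpM2r// mulr_ge0 ?powR_ge0.
have st : s <= b * t.
  apply: (@le_trans _ _ ((K0 * K1 * c `^ r) `^ r^-1 * t)); last first.
    by rewrite ler_wpM2r// /b le_max lexx orbT.
  have tE : t = (t `^ r) `^ r^-1 by rewrite -powRrM divff ?gt_eqF// powRr1.
  rewrite [t in leRHS]tE -powRM.
  - rewrite -ler_powR_inv ?mulr_ge0 ?(ltW K00) ?(ltW K10) ?(ltW cr0) ?(ltW tr)//.
    rewrite -(ler_pM2r N0) (le_trans sN)//.
    have -> : K0 * K1 * c `^ r * t `^ r * N = K0 * (K1 * N * (c `^ r * t `^ r)) by ring.
    by rewrite ler_peMr// ltW.
  - by rewrite !mulr_ge0// ltW.
  - exact: ltW.
have [Ss St] := (class_U_gt0 UPsi s0, class_U_gt0 UPsi t0).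
have bt0 : 0 < b * t by rewrite mulr_gt0.
have : Psi s / s `^ r <= D * (Psi t / t `^ r).
  rewrite (le_trans (almost _ _ s0 st))// /D -[leRHS]mulrA ler_pM2l ?exprn_gt0//.
  rewrite mulrA (mulrC b t); apply: ler_pM; rewrite ?invr_ge0 ?powR_ge0//.
  - by apply/ltW/(class_U_gt0 UPsi); rewrite mulrC.
  - exact: HP.
  - rewrite lef_pV2 ?posrE ?powR_gt0// ?(mulrC t)//.
    by apply: ge0_ler_powR; rewrite ?nnegrE ?(ltW r0) ?(ltW bt0)// ler_peMl.
rewrite ler_pdivrMr// => le.
rewrite ler_pdivrMr// (le_trans le)//.
have -> : D * (K1 * c `^ r) * (s `^ r * N) * Psi t =
    D * (Psi t / t `^ r) * s `^ r * (K1 * N * (c `^ r * t `^ r)).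
  by field; rewrite gt_eqF.
rewrite ler_peMr// mulr_ge0 ?powR_ge0// mulr_ge0 ?(ltW D0)//.
by rewrite divr_ge0 ?powR_ge0// ltW.
Qed.

(** * The Carleson embedding *)

Lemma EFin_fine_le (R : realType) (x : \bar R) : (0 <= x)%E -> ((fine x)%:E <= x)%E.
Proof. by case: x => [x||]//= _; rewrite ?leey. Qed.

(** The doubling of [Psi] rounds each [Psi (A Q)] down to a level that [A Q]
    exceeds, at the cost of counting all lower levels as well.  The packing
    hypothesis on the maximal sets of a level then turns the sum over the
    levels into the integral of a geometric sum dominated by the power [r] of
    the maximal function. *)
Lemma carleson_embedding dT (T : measurableType dT) (R : realType)
    (mu : {measure set T -> \bar R}) (r K0 B Kd : R) (Psi : R -> R)
    (F : seq (set T)) (A lam : set T -> R) (nu : T -> R) :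
  0 < r -> 0 <= B -> 0 <= Kd ->
  (forall s t, 0 <= s -> s <= t -> Psi s <= Psi t) -> Psi 0 = 0 ->
  (forall t, 0 < t -> Psi (2 * t) <= Kd * Psi t) ->
  nested F -> (forall Q, Q \in F -> measurable Q) ->
  (forall Q, 0 <= A Q) -> (forall Q, Q \in F -> 0 <= lam Q) ->
  measurable_fun [set: T] nu -> (forall x, 0 <= nu x) ->
  (\int[mu]_x (max_average F A x `^ r * nu x)%:E <= K0%:E)%E ->
  (forall S s, S \in F -> 0 < s ->
     (\int[mu]_(x in S) (nu x)%:E < +oo)%E ->
     s `^ r * fine (\int[mu]_(x in S) (nu x)%:E)%E <= K0 ->
     Psi s * \sum_(Q <- F | `[< Q `<=` S >]) lam Q <=
       B * (s `^ r * fine (\int[mu]_(x in S) (nu x)%:E)%E)) ->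
  \sum_(Q <- F) lam Q * Psi (A Q) <= Kd * B * (1 - 2 `^ (- r))^-1 * K0.
Proof.
move=> r0 B0 Kd0 mono Psi0 dbl nF mF A0 lam0 mnu nu0 HM pack.
have [eps [m [e0 levF]]] := levels_exist F A.
have v0 i : 0 < level eps i by exact: level_gt0.
have [E EP] := choice (fun i => level_cover A nF (ltW (v0 i))).
have mE i S : S \in E i -> measurable S.
  by have [EF _ _ _] := EP i; move=> /EF; exact: mF.
have Psi_ge0 t : 0 <= t -> 0 <= Psi t by move=> t0; rewrite -Psi0 mono.
set K := (1 - 2 `^ (- r))^-1.
pose N S := fine (\int[mu]_(x in S) (nu x)%:E)%E.
have I0 S : (0 <= \int[mu]_(x in S) (nu x)%:E)%E.
  by apply: integral_ge0 => x _; rewrite lee_fin.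
have mM : measurable_fun [set: T] (fun x => max_average F A x `^ r).
  exact: (measurableT_comp (measurable_powR r) (measurable_max_average A mF)).
(* Chebyshev's inequality: the maximal function is at least [A S] on [S]. *)
have cheb S s : S \in F -> 0 < s -> s < A S ->
    (\int[mu]_(x in S) (nu x)%:E < +oo)%E /\ s `^ r * N S <= K0.
  move=> SF s0 sA; have sr0 : 0 < s `^ r by rewrite powR_gt0.
  have : ((s `^ r)%:E * \int[mu]_(x in S) (nu x)%:E <= K0%:E)%E.
    rewrite -ge0_integralZl//; last 4 first.
    - exact: mF.
    - by apply/measurable_EFinP; exact: measurable_funTS.
    - by move=> x _; rewrite lee_fin.
    - by rewrite lee_fin ltW.
    rewrite integral_mkcond; apply: le_trans HM.
    apply: ae_le_integral; apply: aeW => x _; rewrite patchE.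
    case: (boolP (x \in S)) => [/set_mem Sx|_]; last first.
      by rewrite lee_fin mulr_ge0 ?powR_ge0.
    rewrite -EFinM lee_fin ler_wpM2r// ge0_ler_powR ?nnegrE ?max_average_ge0 ?(ltW r0) ?(ltW s0)//.
    by rewrite (le_trans (ltW sA))//; exact: le_max_average.
  have := I0 S; rewrite /N; case: (\int[mu]_(x in S) (nu x)%:E)%E => [z| |]//=.
    by rewrite -EFinM lee_fin ltry.
  by rewrite gt0_muley ?lte_fin// leye_eq.
have step i : Psi (level eps i) * \sum_(Q <- F | level eps i < A Q) lam Q <=
    \sum_(S <- E i) B * (level eps i `^ r * N S).
  have [EF vE FE _] := EP i.
  (* Every set of the level lies in a maximal one. *)
  apply: (@le_trans _ _ (Psi (level eps i) *
      \sum_(S <- E i) \sum_(Q <- F | `[< Q `<=` S >]) lam Q)).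
    rewrite ler_wpM2l ?Psi_ge0 ?(ltW (v0 i))//.
    under [leRHS]eq_bigr do rewrite big_mkcond.
    rewrite exchange_big/= [leLHS]big_mkcond big_seq [leRHS]big_seq.
    apply: ler_sum => Q QF; have s0 S : 0 <= (if `[< Q `<=` S >] then lam Q else 0).
      by case: ifP => _; rewrite ?lam0.
    case: ifPn => [vQ|_]; last exact: sumr_ge0.
    have [S SE QS] := FE Q QF vQ.
    by rewrite (big_rem S)//= asboolT// lerDl sumr_ge0.
  rewrite mulr_sumr big_seq [leRHS]big_seq; apply: ler_sum => S SE.
  by have [h1 h2] := cheb S _ (EF _ SE) (v0 i) (vE _ SE); exact: pack (EF _ SE) _ _ _.
have X : \sum_(i < m) \sum_(S <- E i) level eps i `^ r * N S <= K * K0.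
  rewrite -lee_fin -sumEFin.
  apply: (@le_trans _ _ (\sum_(i < m) \sum_(S <- E i)
      \int[mu]_(x in S) (level eps i `^ r * nu x)%:E)%E).
    apply: lee_sum => i _; rewrite -sumEFin big_seq [leRHS]big_seq.
    apply: lee_sum => S SE; under eq_integral do rewrite EFinM.
    rewrite ge0_integralZl//; last 4 first.
    - exact: mE SE.
    - by apply/measurable_EFinP; exact: measurable_funTS.
    - by move=> x _; rewrite lee_fin.
    - by rewrite lee_fin powR_ge0.
    by rewrite EFinM lee_wpmul2l ?lee_fin ?powR_ge0// EFin_fine_le.
  rewrite -(@integral_level_sum _ _ _ mu m E (fun i x => level eps i `^ r * nu x)); last 3 first.
  - exact: mE.
  - by move=> i; exact: measurable_funM.
  - by move=> i x; rewrite mulr_ge0 ?powR_ge0.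
  have Kge0 : 0 <= K by rewrite invr_ge0 ltW// sub1_powR2_gt0.
  apply: (@le_trans _ _ (K%:E * \int[mu]_x (max_average F A x `^ r * nu x)%:E)%E); last first.
    by rewrite EFinM lee_wpmul2l ?lee_fin.
  rewrite -ge0_integralZl//; last 2 first.
  - by apply/measurable_EFinP; exact: measurable_funM.
  - by move=> x _; rewrite lee_fin mulr_ge0 ?powR_ge0.
  apply: ae_le_integral; apply: aeW => x _; rewrite -EFinM lee_fin.
  rewrite mulrA; apply: le_trans (ler_wpM2r (nu0 x)
    (sum_level_lt m r0 e0 (max_average_ge0 F A x))).
  rewrite mulr_suml; apply: ler_sum => i _; rewrite -mulr_sumr mulrAC.
  have [_ _ _ /(_ x) Ex] := EP i.
  by rewrite ler_wpM2r// ler_wpM2l ?powR_ge0.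
rewrite -!mulrA mulrA; apply: (@le_trans _ _ (Kd * B *
  (\sum_(i < m) \sum_(S <- E i) level eps i `^ r * N S))); last first.
  by rewrite ler_wpM2l// mulr_ge0.
apply: (@le_trans _ _ (Kd * \sum_(i < m) Psi (level eps i) *
    \sum_(Q <- F | level eps i < A Q) lam Q)); last first.
  rewrite -mulrA ler_wpM2l// mulr_sumr; apply: ler_sum => i _.
  by rewrite (le_trans (step i))// mulr_sumr.
under [X in _ <= Kd * X]eq_bigr do rewrite mulr_sumr big_mkcond.
rewrite exchange_big mulr_sumr big_seq [leRHS]big_seq.
apply: ler_sum => Q QF.
have s0 (i : 'I_m) : 0 <= (if level eps i < A Q then Psi (level eps i) * lam Q else 0).
  by case: ifP => // _; rewrite mulr_ge0 ?lam0// Psi_ge0// ltW.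
have := A0 Q; rewrite le_eqVlt => /orP[/eqP AQ|AQ].
  by rewrite -[A Q in leLHS]AQ Psi0 mulr0 mulr_ge0// sumr_ge0.
have /andP[eQ Qm] := levF _ QF AQ; have [i iQ Qi] := level_between eQ Qm.
rewrite (bigD1 i)//= iQ; apply: (@le_trans _ _ (Kd * (Psi (level eps i) * lam Q))).
  rewrite mulrC mulrA ler_wpM2r ?lam0// (le_trans _ (dbl _ (v0 i)))//.
  by rewrite -levelS mono.
by rewrite ler_wpM2l// lerDl sumr_ge0.
Qed.

(** * Cubes, weights and Orlicz norms *)

Lemma measurable_cube (R : realType) d (l : R) (Q : set (euclid R d)) :
  is_cube l Q -> measurable Q.
Proof.
move=> [a [b [c ->]]].
rewrite (_ : [set _ | _] = \bigcap_(i in [set: 'I_d])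
   ((fun x : euclid R d => tnth x i) @^-1`
     [set` Interval (BSide (b i) (a i)) (BSide (c i) (a i + l))])); last first.
  by apply/seteqP; split => x /= H i => [_|]; exact: H.
apply: fin_bigcap_measurable => // i _.
by rewrite -[X in measurable X]setTI; exact: measurable_tnth.
Qed.

Lemma dyadic_grid_measurable (R : realType) d (D : set (set (euclid R d))) Q :
  dyadic_grid D -> D Q -> measurable Q.
Proof. by move=> gD /(grid_cube gD)[k]; exact: measurable_cube. Qed.

Lemma dyadic_grid_nested (R : realType) d (D : set (set (euclid R d)))
    (F : seq (set (euclid R d))) :
  dyadic_grid D -> (forall Q, Q \in F -> D Q) -> nested F.
Proof.
move=> gD FD Q S /FD DQ /FD DS.
have [h|h|h] := grid_nested gD DQ DS.
- by apply: Or31; rewrite -h; exact: subIsetr.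
- by apply: Or32; rewrite -h; exact: subIsetl.
- exact: Or33.
Qed.

Lemma weight_borel (R : realType) d (sigma : euclid R d -> R) :
  weight sigma -> exists w : euclid R d -> R,
    [/\ measurable_fun [set: euclid R d] w, forall x, 0 < w x &
        {ae lebesgue_euclid d, forall x, sigma x = w x}].
Proof.
move=> [[g mg sg] _ s0]; exists (fun x => if 0 < g x then g x else 1); split.
- by apply: measurable_fun_ifT => //; exact: measurable_fun_ltr.
- by move=> x; case: ifP.
- by apply: filterS2 sg s0 => x -> ->.
Qed.

Lemma normc_borel (R : realType) d (f : euclid R d -> complex R) :
  lebesgue_measurableC f -> exists h : euclid R d -> R,
    [/\ measurable_fun [set: euclid R d] h, forall x, 0 <= h x &
        {ae lebesgue_euclid d, forall x,
          ComplexField.Normc.normc (f x) = h x}].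
Proof.
move=> [[g mg fg] [k mk fk]].
exists (fun x => (g x ^+ 2 + k x ^+ 2) `^ 2^-1); split.
- apply: (measurableT_comp (measurable_powR 2^-1)).
  by apply: measurable_funD; exact: measurable_funX.
- by move=> x; exact: powR_ge0.
- apply: filterS2 fg fk => x; case: (f x) => a b /= -> ->.
  by rewrite powR12_sqrt// addr_ge0 ?sqr_ge0.
Qed.

(** Some admissible [l] is below twice the Luxemburg norm, which costs a factor
    [2 `^ q] and spares the passage to the limit in [l].  When the norm is [0]
    the normalized function vanishes by the convention on division. *)
Lemma luxnorm_power_bound (R : realType) d (q kappa : R) (Phi : R -> R)
    (sigma w h : euclid R d -> R) (f : euclid R d -> complex R) :
  0 < q -> 0 < kappa -> Phi 0 = 0 ->
  (forall t, 0 < t -> t `^ q <= kappa * Phi t) ->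
  (luxnorm Phi sigma f < +oo)%E ->
  measurable_fun [set: euclid R d] w -> (forall x, 0 < w x) ->
  {ae lebesgue_euclid d, forall x, sigma x = w x} ->
  measurable_fun [set: euclid R d] h -> (forall x, 0 <= h x) ->
  {ae lebesgue_euclid d, forall x, ComplexField.Normc.normc (f x) = h x} ->
  (\int[lebesgue_euclid d]_x
     ((h x / fine (luxnorm Phi sigma f)) `^ q * w x)%:E <=
       (2 `^ q * kappa)%:E)%E.
Proof.
move=> q0 k0 Phi0 low Lfin mw w0 sw mh h0 fh.
set L := fine (luxnorm Phi sigma f).
have K0 : 0 < 2 `^ q * kappa by rewrite mulr_gt0// powR_gt0.
have L0 : (0 <= luxnorm Phi sigma f)%E.
  by apply: le_ereal_inf_tmp => _ [l [l0 _] <-]; rewrite lee_fin ltW.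
have LE : luxnorm Phi sigma f = L%:E by rewrite fineK// ge0_fin_numE.
have := L0; rewrite LE lee_fin le_eqVlt => /orP[/eqP <-|Lpos].
  rewrite integral0_eq ?lee_fin ?(ltW K0)// => x _.
  by rewrite invr0 mulr0 powR0 ?gt_eqF// mul0r.
have : (luxnorm Phi sigma f < (2 * L)%:E)%E by rewrite LE lte_fin; lra.
move=> /ereal_inf_lt[_ [l [l0 Il] <-]]; rewrite lte_fin => lL.
have mG : measurable_fun [set: euclid R d] (fun x => (h x / L) `^ q * w x).
  apply: measurable_funM => //; apply: (measurableT_comp (measurable_powR q)).
  exact: measurable_funM.
have G0 x : 0 <= (h x / L) `^ q * w x by rewrite mulr_ge0 ?powR_ge0// ltW.
have : (\int[lebesgue_euclid d]_x
    ((2 `^ q * kappa)^-1%:E * ((h x / L) `^ q * w x)%:E) <= 1)%E.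
  apply: le_trans Il; apply: ae_le_integral; apply: filterS2 sw fh => x -> -> _.
  rewrite -EFinM lee_fin mulrA ler_wpM2r ?(ltW (w0 x))//.
  rewrite ler_pdivrMl// -mulrA.
  have := h0 x; rewrite le_eqVlt => /orP[/eqP <-|hx].
    by rewrite !mul0r Phi0 powR0 ?gt_eqF// !mulr0.
  apply: (@le_trans _ _ ((2 * (h x / l)) `^ q)).
    apply: ge0_ler_powR; rewrite ?nnegrE ?(ltW q0)//.
    - by rewrite divr_ge0// ltW.
    - by rewrite mulr_ge0// divr_ge0// ltW.
    - by rewrite mulrCA ler_pM2l// ler_pdivlMr// mulrC ler_pdivrMr// ltW.
  rewrite powRM// ?divr_ge0 ?(ltW l0)// ler_pM2l ?powR_gt0// low//.
  exact: divr_gt0.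
rewrite ge0_integralZl//; last 3 first.
- exact/measurable_EFinP.
- by move=> x _; rewrite lee_fin.
- by rewrite lee_fin invr_ge0 ltW.
by rewrite muleC lee_pdivrMr// mul1e.
Qed.

(** The conventions [fine +oo = 0] and [0^-1 = 0] only make the formal average
    vanish, so that the two bounds of the maximal inequality hold for all
    sets. *)
Lemma formal_average dT (T : measurableType dT) (R : realType)
    (mu : {measure set T -> \bar R}) (Q : set T) (w f : T -> R) :
  (forall x, 0 <= w x) -> (forall x, 0 <= f x) ->
  let a := (fine (\int[mu]_(x in Q) (w x)%:E)%E)^-1 *
           fine (\int[mu]_(x in Q) (f x * w x)%:E)%E in
  0 <= a /\ (0 < a ->
    (\int[mu]_(x in Q) (w x)%:E < +oo)%E /\
    (a%:E * \int[mu]_(x in Q) (w x)%:E <=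
       \int[mu]_(x in Q) (f x * w x)%:E)%E).
Proof.
move=> w0 f0.
have : (0 <= \int[mu]_(x in Q) (w x)%:E)%E.
  by apply: integral_ge0 => x _; rewrite lee_fin.
have : (0 <= \int[mu]_(x in Q) (f x * w x)%:E)%E.
  by apply: integral_ge0 => x _; rewrite lee_fin mulr_ge0.
move: (\int[mu]_(x in Q) (f x * w x)%:E)%E (\int[mu]_(x in Q) (w x)%:E)%E.
move=> I W I0 W0 /=; split; first by rewrite mulr_ge0 ?invr_ge0 ?fine_ge0.
case: W W0 => [W W0| _|//]/=; last first.
  by rewrite invr0 mul0r => h; rewrite ltxx in h.
have := W0; rewrite lee_fin le_eqVlt => /orP[/eqP <-|Wpos].
  by rewrite invr0 mul0r => h; rewrite ltxx in h.
move=> _; split; first exact: ltry.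
by rewrite -EFinM mulrAC mulVf ?gt_eqF// mul1r EFin_fine_le.
Qed.

(** A weighted mean of arithmetic-geometric type: every factor is at most the
    power [e i] of the sum. *)
Lemma prod_powR_le_sum (R : realType) n (b e : 'I_n -> R) :
  (0 < n)%N -> (forall i, 0 <= b i) -> (forall i, 0 < e i) ->
  \sum_(i < n) e i = 1 -> \prod_(i < n) b i `^ e i <= \sum_(i < n) b i.
Proof.
move=> n0 b0 e0 e1.
have bS i : b i <= \sum_(j < n) b j by rewrite (bigD1 i)//= lerDl sumr_ge0.
have S0 : 0 <= \sum_(j < n) b j by exact: sumr_ge0.
have := S0; rewrite le_eqVlt => /orP[/eqP SE|S1].
  rewrite (bigD1 (Ordinal n0))//= (_ : b _ = 0).
    by rewrite powR0 ?gt_eqF// mul0r.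
  by apply/eqP; rewrite eq_le b0 andbT SE.
rewrite -[leRHS]powRr1// -[X in _ `^ X]e1 -prod_powR//; apply: ler_prod => i _.
by rewrite powR_ge0/= ge0_ler_powR ?nnegrE// ltW.
Qed.

(** Each [inv_Rplus (Phis i) (w i)^-1] is at least a multiple of
    [w i `^ - (q i)^-1], and [Phi] of their product is comparable to the power
    [r] of that product. *)
Lemma nu_weight_bound (R : realType) (n : nat) (Phis : 'I_n -> R -> R)
    (Phi : R -> R) (q kappa : 'I_n -> R) (r c : R) (w : 'I_n -> R) :
  0 < r -> (forall i, 0 < q i) -> (forall i, 0 < kappa i) ->
  (forall i, class_U (Phis i)) ->
  (forall i t, 0 < t ->
     Phis i t <= kappa i * t `^ q i /\ t `^ q i <= kappa i * Phis i t) ->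
  (forall t, 0 < t ->
     [/\ 0 < Phi t, Phi t <= c * t `^ r & t `^ r <= c * Phi t]) ->
  (forall i, 0 < w i) ->
  0 <= (Phi (\prod_(i < n) inv_Rplus (Phis i) (w i)^-1))^-1 <=
    c * \prod_(i < n) kappa i `^ (r / q i) * \prod_(i < n) w i `^ (r / q i).
Proof.
move=> r0 q0 k0 UPhi pow PhiP w0.
have wV0 i : 0 < (w i)^-1 by rewrite invr_gt0.
have ipow i := inv_Rplus_power (q0 i) (k0 i) (UPhi i) (pow i) (wV0 i).
set s := fun i => inv_Rplus (Phis i) (w i)^-1 in ipow *.
have s0 i : 0 < s i by have [] := ipow i.
set P := \prod_(i < n) s i.
have P0 : 0 < P by exact: prodr_gt0.
have [PhiP0 _ low] := PhiP P P0.
rewrite invr_ge0 (ltW PhiP0)/= -[leLHS]mul1r ler_pdivrMr//.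
set X := \prod_(i < n) kappa i `^ _; set Y := \prod_(i < n) w i `^ _.
have X0 : 0 <= X by apply: prodr_ge0 => i _; exact: powR_ge0.
have Y0 : 0 <= Y by apply: prodr_ge0 => i _; exact: powR_ge0.
apply: (@le_trans _ _ (X * Y * P `^ r)); last first.
  rewrite -[leRHS]mulrA -mulrA [leLHS]mulrCA (_ : c * X * _ = Y * (X * (c * Phi P))); last by ring.
  by rewrite mulrCA; rewrite [leRHS]mulrCA ler_wpM2l// ler_wpM2l.
rewrite powR_prod; last by move=> i; exact: ltW.
rewrite /X /Y -!big_split/=.
apply: (@le_trans _ _ (\prod_(i < n) 1)); first by rewrite big1.
apply: ler_prod => i _; rewrite ler01/=.
have [_ h _] := ipow i.
have wq : 0 < w i `^ (q i)^-1 by rewrite powR_gt0.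
have : 1 <= kappa i `^ (q i)^-1 * w i `^ (q i)^-1 * s i.
  by rewrite mulrAC -ler_pdivrMr// div1r -powRN -mulN1r powRrM powR_inv1 ?(ltW (w0 i)).
move=> h1; have := @ge0_ler_powR _ r (ltW r0) 1 _ _ _ h1.
rewrite powR1 !nnegrE ler01 (le_trans ler01 h1) => /(_ isT isT) /le_trans; apply.
by rewrite !powRM ?mulr_ge0 ?powR_ge0 ?(ltW (s0 i))// -!powRrM ![_^-1 * r]mulrC.
Qed.

(** * The multilinear embedding *)

Theorem theorem3p2 (R : realType) (n : nat) (hn : (0 < n)%N)
    (Phis : 'I_n -> R -> R) (Psi Phi : R -> R)
    (hPhis : forall i, [/\ class_Utilde (Phis i), standing_U (Phis i) &
                           nabla_2 (Phis i)])
    (hPsi : class_U Psi /\ standing_U Psi)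
    (hPhi : set_bij Rplus Rplus Phi)
    (hinv : forall y, 0 <= y ->
       inv_Rplus Phi y = \prod_(i < n) inv_Rplus (Phis i) y)
    (hmono : forall s t, 0 < s -> s <= t -> Psi s / Phi s <= Psi t / Phi t) :
  exists2 C : R, 0 < C &
    forall (d : nat) (D : set (set (euclid R d)))
      (lam : set (euclid R d) -> R) (sigma : 'I_n -> euclid R d -> R)
      (Lam : R),
    (0 < d)%N -> dyadic_grid D -> (forall Q, D Q -> 0 < lam Q) ->
    (forall i, weight (sigma i)) -> 0 < Lam ->
    (forall S, D S ->
       (\esum_(Q in [set Q | D Q /\ Q `<=` S]) (lam Q)%:E
          <= (Lam / Psi (inv_Rplus Phi
                (wmeas (nu_weight Phi Phis sigma) S)^-1))%:E)%E) ->
    forall f : 'I_n -> euclid R d -> complex R,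
    (forall i, orlicz (Phis i) (sigma i) (f i)) ->
    (forall i, ~ {ae lebesgue_euclid d, forall x, f i x = 0}) ->
    (\esum_(Q in D)
       (lam Q * Psi (\prod_(i < n)
          ((wmeas (sigma i) Q)^-1 *
           \int[lebesgue_euclid d]_(x in Q)
             (ComplexField.Normc.normc (f i x) /
              fine (luxnorm (Phis i) (sigma i) (f i)) * sigma i x))))%:E
       <= (C * Lam)%:E)%E.
Proof.
have UPhis i : class_U (Phis i).
  by have [[p p1 [Up _ _]] _ _] := hPhis i; exists p.
have UPsi := hPsi.1.
have Phis0 i : Phis i 0 = 0 by have [p _ [/growth_at0]] := UPhis i.
have Psi0 : Psi 0 = 0 by have [p _ [/growth_at0]] := UPsi.
(* The pairs of an exponent and of a comparison constant. *)
have /choice[qk qkP] : forall i, exists p : R * R, [/\ 1 < p.1, 0 < p.2 &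
    forall t, 0 < t ->
      Phis i t <= p.2 * t `^ p.1 /\ t `^ p.1 <= p.2 * Phis i t].
  move=> i; have [[p p1 Up] _ nabla] := hPhis i.
  have [k k0 pow] := class_Utildeq_power p1 Up.
  exists (p, k); split => //; apply: (nabla_2_power_gt1 k0 nabla) => t t0.
  exact: (pow t t0).2.
pose q i := (qk i).1; pose kappa i := (qk i).2.
have q1 i : 1 < q i by have [] := qkP i.
have k0 i : 0 < kappa i by have [] := qkP i.
have pow i t : 0 < t ->
    Phis i t <= kappa i * t `^ q i /\ t `^ q i <= kappa i * Phis i t.
  by have [_ _] := qkP i; exact.
have q0 i : 0 < q i := lt_trans ltr01 (q1 i).
have [c c0 [invP PhiP]] :=
  prod_inv_power hn q0 k0 UPhis pow hPhi hinv.
set r := (\sum_(i < n) (q i)^-1)^-1 in invP PhiP.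
have r0 : 0 < r.
  rewrite invr_gt0 (bigD1 (Ordinal hn))//= ltr_pwDl// ?invr_gt0//.
  by rewrite sumr_ge0// => i _; rewrite invr_ge0 ltW.
have inv0 : inv_Rplus Phi 0 = 0.
  by rewrite hinv// (bigD1 (Ordinal hn))//= class_U_inv0// mul0r.
have /choice[Cm CmP] i := maximal_inequality (q1 i).
(* [K0] bounds the integral of the multilinear maximal function, and [K1]
   compares [nu] with the product of the powers of the weights. *)
pose K0 := \sum_(i < n) Cm i * (2 `^ q i * kappa i).
have Cm0 i : 0 < Cm i by have [] := CmP i.
have K0i i : 0 < Cm i * (2 `^ q i * kappa i).
  by apply: mulr_gt0 => //; apply: mulr_gt0 => //; exact: powR_gt0.
have K00 : 0 < K0.
  rewrite /K0 (bigD1 (Ordinal hn))//= ltr_pwDl// sumr_ge0// => i _.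
  exact: ltW.
pose K1 := c * \prod_(i < n) kappa i `^ (r / q i).
have K10 : 0 < K1 by rewrite mulr_gt0// prodr_gt0// => i _; rewrite powR_gt0.
have [K Kpos packP] :=
  packing_level_bound r0 c0 K00 K10 UPsi inv0 invP PhiP hmono.
have [qP _ [GPsi [qP0 [CP CP0 HP]] _]] := UPsi.
pose Kd := CP * 2 `^ qP.
have Kd0 : 0 < Kd by rewrite mulr_gt0// powR_gt0.
exists (Kd * K * (1 - 2 `^ (- r))^-1 * K0).
  by rewrite mulr_gt0// mulr_gt0 ?invr_gt0 ?sub1_powR2_gt0// mulr_gt0.
move=> d D lam sigma Lam d0 gD lam0 wsig Lam0 carl f forl _.
have /choice[w wP] i := weight_borel (wsig i).
have /choice[h hP] i := normc_borel (forl i).1.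
set mu := lebesgue_euclid d.
pose L i := fine (luxnorm (Phis i) (sigma i) (f i)).
have L0 i : 0 <= L i.
  apply: fine_ge0; apply: le_ereal_inf_tmp => _ [l [l0 _] <-].
  by rewrite lee_fin ltW.
pose g i x := h i x / L i.
have mw i : measurable_fun [set: euclid R d] (w i) by have [] := wP i.
have w0 i x : 0 < w i x by have [_ + _] := wP i; exact.
have sw i : {ae mu, forall x, sigma i x = w i x} by have [] := wP i.
have mh i : measurable_fun [set: euclid R d] (h i) by have [] := hP i.
have h0 i x : 0 <= h i x by have [_ + _] := hP i; exact.
have fh i : {ae mu, forall x, ComplexField.Normc.normc (f i x) = h i x}.
  by have [] := hP i.
have mg i : measurable_fun [set: euclid R d] (g i) by exact: measurable_funM.
have g0 i x : 0 <= g i x by rewrite divr_ge0.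
have w0' i x : 0 <= w i x := ltW (w0 i x).
pose a i Q := (fine (\int[mu]_(x in Q) (w i x)%:E)%E)^-1 *
  fine (\int[mu]_(x in Q) (g i x * w i x)%:E)%E.
have aP i Q := formal_average mu Q (w0' i) (g0 i).
have a0 i Q : 0 <= a i Q by have [] := aP i Q.
pose A Q := \prod_(i < n) a i Q.
have AE Q : \prod_(i < n) ((wmeas (sigma i) Q)^-1 * \int[mu]_(x in Q)
    (ComplexField.Normc.normc (f i x) /
     fine (luxnorm (Phis i) (sigma i) (f i)) * sigma i x)) = A Q.
  apply: eq_bigr => i _; rewrite /wmeas /Rintegral /a; congr (_^-1 * _).
    by congr fine; apply: ae_eq_integralW; apply: filterS (sw i) => x ->.
  congr fine; apply: ae_eq_integralW; apply: filterS2 (sw i) (fh i) => x -> ->.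
  by [].
(* From here on the weights and the functions are replaced by Borel versions. *)
under eq_esum do rewrite AE.
pose nut x := \prod_(i < n) w i x `^ (r / q i).
have mnut : measurable_fun [set: euclid R d] nut.
  apply: measurable_prod => i _.
  exact: (measurableT_comp (measurable_powR _) (mw i)).
have nut0 x : 0 <= nut x by apply: prodr_ge0 => i _; exact: powR_ge0.
have nuP : {ae mu, forall x, 0 <= nu_weight Phi Phis sigma x <= K1 * nut x}.
  have : {ae mu, forall x, forall i, sigma i x = w i x}.
    by apply: filter_forall => i; exact: sw.
  apply: filterS => x sx; rewrite /nu_weight; under eq_bigr do rewrite sx.
  exact: (nu_weight_bound r0 q0 k0 UPhis pow PhiP (fun i => w0 i x)).
apply: ge_ereal_sup => _ [X [finX XD] <-].
rewrite fsbig_finite//= sumEFin lee_fin.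
set F : seq (set (euclid R d)) := fset_set X.
have FX Q : Q \in F -> X Q by move=> QF; apply: set_mem; rewrite -in_fset_set.
have FD Q : Q \in F -> D Q by move=> /FX; exact: XD.
have nF : nested F := dyadic_grid_nested gD FD.
have mF Q : Q \in F -> measurable Q.
  by move=> /FD; exact: dyadic_grid_measurable.
pose M i := max_average F (a i).
have mM i : measurable_fun [set: euclid R d] (fun x => M i x `^ q i * w i x).
  apply: measurable_funM => //.
  exact: (measurableT_comp (measurable_powR _) (measurable_max_average _ mF)).
have Mw0 i x : 0 <= M i x `^ q i * w i x by rewrite mulr_ge0 ?powR_ge0.
have HM : (\int[mu]_x (max_average F A x `^ r * nut x)%:E <= K0%:E)%E.
  apply: (@le_trans _ _
      (\int[mu]_x (\sum_(i < n) (M i x `^ q i * w i x)%:E))%E).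
    apply: ae_le_integral; apply: aeW => x _; rewrite sumEFin lee_fin.
    have := max_average_ge0 F A x; rewrite le_eqVlt => /orP[/eqP <-|MA0].
      by rewrite powR0 ?gt_eqF// mul0r sumr_ge0.
    have [Q [QF Qx ->]] := max_average_attained MA0.
    have rq i : 0 < r / q i by rewrite divr_gt0.
    apply: le_trans (prod_powR_le_sum hn (Mw0^~ x) rq _); last first.
      by rewrite -mulr_sumr mulVf// gt_eqF// -invr_gt0.
    rewrite /nut powR_prod// -big_split/=; apply: ler_prod => i _.
    rewrite mulr_ge0 ?powR_ge0//= powRM ?powR_ge0// ler_wpM2r ?powR_ge0//.
    rewrite -powRrM mulrCA divff ?gt_eqF// mulr1.
    apply: ge0_ler_powR; rewrite ?nnegrE ?(ltW r0) ?max_average_ge0//.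
    exact: le_max_average.
  rewrite ge0_integral_sum//; last 2 first.
  - by move=> i; exact/measurable_EFinP.
  - by move=> i x _; rewrite lee_fin.
  rewrite -sumEFin; apply: lee_sum => i _.
  have [_ maxP] := CmP i; apply: le_trans (maxP _ _ mu F (a i) (w i) (g i)
    nF mF (mw i) (mg i) (w0' i) (g0 i) _) _.
    by move=> Q _; have [_] := aP i Q; exact.
  rewrite EFinM lee_wpmul2l ?lee_fin ?(ltW (Cm0 i))//.
  apply: luxnorm_power_bound => //; first by move=> t t0; exact: (pow i t t0).2.
  exact: (forl i).2.
have -> : Kd * K * (1 - 2 `^ (- r))^-1 * K0 * Lam =
  Kd * (K * Lam) * (1 - 2 `^ (- r))^-1 * K0 by ring.
apply: (carleson_embedding r0 _ _ _ Psi0 _ nF mF _ _ mnut nut0 HM) => //.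
- by rewrite mulr_ge0// ltW.
- exact: ltW.
- by move=> s t; exact: growth_nondecreasing.
- by move=> t t0; have := HP t 2 t0; rewrite mulrC => -> //; rewrite ler1n.
- by move=> Q; exact: prodr_ge0.
- by move=> Q /FD /lam0 /ltW.
move=> S s SF s0 Noo sN; set m := wmeas (nu_weight Phi Phis sigma) S.
have lamS : \sum_(Q <- F | `[< Q `<=` S >]) lam Q <=
    Lam / Psi (inv_Rplus Phi m^-1).
  rewrite -lee_fin; apply: le_trans (carl S (FD S SF)).
  apply: esum_ge; exists (X `&` [set Q | Q `<=` S]).
    split; first exact: finite_setIl.
    by move=> Q [XQ QS]; split => //; exact: XD.
  rewrite fsbig_mkcondr fsbig_finite//= -sumEFin big_mkcond/=.
  apply: lee_sum => Q _.
  by case: asboolP => QS; [rewrite mem_set|rewrite memNset].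
have N0 : (0 <= \int[mu]_(x in S) (nut x)%:E)%E.
  by apply: integral_ge0 => x _; rewrite lee_fin.
have nuS0 : (0 <= \int[mu]_(x in S) (nu_weight Phi Phis sigma x)%:E)%E.
  rewrite -(@integral0 _ _ R mu S); apply: ae_le_integral.
  by apply: filterS nuP => x /andP[nu0 _] _; rewrite lee_fin.
have m0 : 0 <= m by apply: fine_ge0.
have mN : m <= K1 * fine (\int[mu]_(x in S) (nut x)%:E)%E.
  have : (\int[mu]_(x in S) (nu_weight Phi Phis sigma x)%:E <=
      K1%:E * \int[mu]_(x in S) (nut x)%:E)%E.
    rewrite -ge0_integralZl//; last 4 first.
    - exact: mF.
    - by apply/measurable_EFinP; exact: measurable_funTS.
    - by move=> x _; rewrite lee_fin.
    - by rewrite lee_fin ltW.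
    apply: ae_le_integral; apply: filterS nuP => x /andP[_ nu1] _.
    by rewrite -EFinM lee_fin.
  have Nfin : (\int[mu]_(x in S) (nut x)%:E)%E \is a fin_num.
    by rewrite ge0_fin_numE.
  rewrite -{1}(fineK Nfin) -EFinM => nuN.
  by rewrite -lee_fin (le_trans _ nuN)// EFin_fine_le.
apply: (@le_trans _ _ (Psi s * (Lam / Psi (inv_Rplus Phi m^-1)))).
  by rewrite ler_wpM2l// ltW// class_U_gt0.
rewrite mulrCA [leRHS]mulrAC mulrC ler_wpM2r ?(ltW Lam0)//.
exact: packP.
Qed.
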